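(* Over $\Bbbk=\mathbb C(q)$, the $\mathbb C(q)$-linear monoidal categories $\mathbf{Web}^{\bullet\prime}$ and $\mathbf{Web}^\bullet$ are isomorphic by matching the generating objects and generating morphisms with the same symbols: there is an isomorphism of strict $\mathbb C(q)$-linear monoidal categories $\mathbf{Web}^{\bullet\prime}\to\mathbf{Web}^\bullet$ with $a\mapsto a$, $\mathsf m_{a,b}\mapsto\mathsf m_{a,b}$, $\mathsf s_{a,b}\mapsto\mathsf s_{a,b}$, $\mathsf c_{a,b}\mapsto\mathsf c_{a,b}$, and $\mathsf x_a\mapsto\mathsf x_a$ for all $a,b\ge1$, where $\mathsf x_a$ for $a\ge 2$ is defined in $\mathbf{Web}^{\bullet\prime}$ by $\mathsf x_a=\frac1{[a]!}\mathsf m_{1^a}\mathsf x_1^{\otimes a}\mathsf s_{1^a}$ (and the element $\frac1{[a]!}\mathsf m_{1^a}(\mathsf x_1^{-1})^{\otimes a}\mathsf s_{1^a}$ is sent to $\mathsf x_a^{-1}$).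
   Context: **Notation.** $[n]=\frac{q^n-q^{-n}}{q-q^{-1}}$, $[a]!=[1][2]\cdots[a]$, $\begin{bmatrix}n\\ a\end{bmatrix}=\frac{[n][n-1]\cdots[n-a+1]}{[a]!}$. In a strict monoidal category, $fg=f\circ g$, $\otimes$ is horizontal juxtaposition. Strands of thickness $0$ are deleted: $0$ is the unit object, and merges, splits, crossings and dots involving a $0$ are identities. Iterated merges and splits (well defined by (W1)) are $\mathsf m_{a_1,\dots,a_k}$, $\mathsf s_{a_1,\dots,a_k}$; $1^a=(1,\dots,1)$ ($a$ ones). **$\mathbf{Web}^\bullet$** (over $\mathbb C(q)$) is the strict $\mathbb C(q)$-linear monoidal category with generating objects $a\in\mathbb Z_{\ge1}$ and generating morphisms $\mathsf m_{a,b}:a\otimes b\to a+b$, $\mathsf s_{a,b}:a+b\to a\otimes b$, $\mathsf c_{a,b}:a\otimes b\to b\otimes a$, $\mathsf x_a:a\to a$, with $\mathsf c_{a,b}$ and $\mathsf x_a$ invertible, subject to, for all $a,b,c,d\ge1$: (W1) $\mathsf m_{a+b,c}(\mathsf m_{a,b}\otimes1_c)=\mathsf m_{a,b+c}(1_a\otimes\mathsf m_{b,c})$, $(\mathsf s_{a,b}\otimes1_c)\mathsf s_{a+b,c}=(1_a\otimes\mathsf s_{b,c})\mathsf s_{a,b+c}$; (W2) if $a+c=b+d$: $\mathsf s_{b,d}\mathsf m_{a,c}=\sum q^{st}(\mathsf m_{s,b-s}\otimes\mathsf m_{a-s,t})(1_s\otimes\mathsf c_{a-s,c-t}\otimes1_t)(\mathsf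 s_{s,a-s}\otimes\mathsf s_{c-t,t})$, over $0\le s\le\min(a,b)$, $0\le t\le\min(c,d)$, $t-s=d-a$; (W3) $\mathsf m_{a,b}\mathsf s_{a,b}=\begin{bmatrix}a+b\\ a\end{bmatrix}1_{a+b}$; (W4) $\mathsf c_{a,b}(\mathsf x_a\otimes1_b)=(1_b\otimes\mathsf x_a)\mathsf c_{b,a}^{-1}$, $(\mathsf x_b\otimes1_a)\mathsf c_{a,b}=\mathsf c_{b,a}^{-1}(1_a\otimes\mathsf x_b)$; (W5) $\mathsf s_{a,b}\mathsf x_{a+b}=(\mathsf x_a\otimes\mathsf x_b)\mathsf s_{a,b}$, $\mathsf x_{a+b}\mathsf m_{a,b}=\mathsf m_{a,b}(\mathsf x_a\otimes\mathsf x_b)$; (W6) $\mathsf m_{1^a}\,\mathsf x_1^{\otimes a}\,\mathsf s_{1^a}=[a]!\,\mathsf x_a$, $\mathsf m_{1^a}(\mathsf x_1^{-1})^{\otimes a}\mathsf s_{1^a}=[a]!\,\mathsf x_a^{-1}$. **$\mathbf{Web}^{\bullet\prime}$** is the strict $\mathbb C(q)$-linear monoidal category with generating objects $a\in\mathbb Z_{\ge1}$, generating morphisms $\mathsf m_{a,b},\mathsf s_{a,b},\mathsf c_{a,b}$ ($a,b\ge1$) and $\mathsf x_1:1\to1$, with $\mathsf c_{a,b}$ and $\mathsf x_1$ invertible, subject to (W1), (W2), (W3), and (W4) only for $a=b=1$. *)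

(* Defs.v *)
From HB Require Import structures.
From mathcomp Require Import all_boot all_order all_algebra.
From mathcomp Require Import boolp reals.
From mathcomp Require Import complex zify.

Set Implicit Arguments.
Unset Strict Implicit.
Unset Printing Implicit Defensive.

Import GRing.Theory.
Local Open Scope ring_scope.

(* A morphism packed with its source and target. The laws of a strict monoidal
   category equate morphisms whose types are only propositionally equal; these
   equations are stated between packed morphisms. *)
Definition arrow (k : fieldType) (ob : Type) (hom : ob -> ob -> lmodType k) :
  Type := {uv : ob * ob & hom uv.1 uv.2}.

Definition pack (k : fieldType) (ob : Type) (hom : ob -> ob -> lmodType k)
    (u v : ob) (f : hom u v) : arrow hom :=
  existT (fun uv => hom uv.1 uv.2 : Type) (u, v) f.

Record slmcat (k : fieldType) := SLMCat {
  ob :> Type;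
  hom : ob -> ob -> lmodType k;
  idm : forall u, hom u u;
  compm : forall u v w, hom v w -> hom u v -> hom u w;
  unit_ob : ob;
  tens_ob : ob -> ob -> ob;
  tensm : forall u v u' v', hom u v -> hom u' v' ->
    hom (tens_ob u u') (tens_ob v v');
  compmA : forall u v w x (f : hom w x) (g : hom v w) (h : hom u v),
    compm f (compm g h) = compm (compm f g) h;
  comp_idl : forall u v (f : hom u v), compm (idm v) f = f;
  comp_idr : forall u v (f : hom u v), compm f (idm u) = f;
  comp_linl : forall u v w (g : hom u v) c (f f' : hom v w),
    compm (c *: f + f') g = c *: compm f g + compm f' g;
  comp_linr : forall u v w (f : hom v w) c (g g' : hom u v),
    compm f (c *: g + g') = c *: compm f g + compm f g';
  tens_obA : associative tens_ob;
  tens_ob1l : left_id unit_ob tens_ob;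
  tens_ob1r : right_id unit_ob tens_ob;
  tens_idm : forall u v, tensm (idm u) (idm v) = idm (tens_ob u v);
  tens_comp : forall u v w u' v' w' (f : hom v w) (g : hom u v)
    (f' : hom v' w') (g' : hom u' v'),
    tensm (compm f g) (compm f' g') = compm (tensm f f') (tensm g g');
  tens_linl : forall u v u' v' (g : hom u' v') c (f f' : hom u v),
    tensm (c *: f + f') g = c *: tensm f g + tensm f' g;
  tens_linr : forall u v u' v' (f : hom u v) c (g g' : hom u' v'),
    tensm f (c *: g + g') = c *: tensm f g + tensm f g';
  tensA : forall u v u' v' u'' v''
    (f : hom u v) (g : hom u' v') (h : hom u'' v''),
    pack (tensm f (tensm g h)) = pack (tensm (tensm f g) h);
  tens1l : forall u v (f : hom u v), pack (tensm (idm unit_ob) f) = pack f;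
  tens1r : forall u v (f : hom u v), pack (tensm f (idm unit_ob)) = pack f
}.

Record slmfunctor (k : fieldType) (C D : slmcat k) := SLMFunctor {
  fun_ob :> C -> D;
  fun_hom : forall u v : C, hom u v -> hom (fun_ob u) (fun_ob v);
  fun_lin : forall (u v : C) c (f g : hom u v),
    fun_hom (c *: f + g) = c *: fun_hom f + fun_hom g;
  fun_idm : forall u : C, fun_hom (idm u) = idm (fun_ob u);
  fun_comp : forall (u v w : C) (f : hom v w) (g : hom u v),
    fun_hom (compm f g) = compm (fun_hom f) (fun_hom g);
  fun_unit : fun_ob (unit_ob C) = unit_ob D;
  fun_tens_ob : forall u v : C,
    fun_ob (tens_ob u v) = tens_ob (fun_ob u) (fun_ob v);
  fun_tens : forall (u v u' v' : C) (f : hom u v) (g : hom u' v'),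
    pack (fun_hom (tensm f g)) = pack (tensm (fun_hom f) (fun_hom g))
}.

Definition slm_isomorphism (k : fieldType) (C D : slmcat k)
    (F : slmfunctor C D) : Prop :=
  exists G : slmfunctor D C,
    [/\ cancel F G, cancel G F,
        forall (u v : C) (f : hom u v), pack (fun_hom G (fun_hom F f)) = pack f
      & forall (u v : D) (f : hom u v), pack (fun_hom F (fun_hom G f)) = pack f].

Record signature := Signature {
  gen_ob : eqType;
  gen_mor : Type;
  gen_src : gen_mor -> seq gen_ob;
  gen_tgt : gen_mor -> seq gen_ob
}.

(* Raw expressions in the generating morphisms; only the [typed] ones denote
   morphisms. Objects are words in the generating objects. *)
Inductive term (k : fieldType) (S : signature) : Type :=
| Id of seq (gen_ob S)
| Gen of gen_mor S
| Comp of term k S & term k S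
| Tens of term k S & term k S
| Zero of seq (gen_ob S) & seq (gen_ob S)
| Add of term k S & term k S
| Scale of k & term k S.

Arguments Id {k S}.
Arguments Gen {k S}.
Arguments Zero {k S}.

Declare Scope term_scope.
Delimit Scope term_scope with T.
Bind Scope term_scope with term.
Reserved Notation "f \ox g" (at level 40, left associativity).
Notation "f \o g" := (Comp f g) : term_scope.
Notation "f \ox g" := (Tens f g) : term_scope.

Section Typing.
Variables (k : fieldType) (S : signature).
Local Notation term := (term k S).

Fixpoint src (t : term) : seq (gen_ob S) :=
  match t with
  | Id u => u
  | Gen g => gen_src g
  | Comp f g => src g
  | Tens f g => src f ++ src g
  | Zero u v => u
  | Add f g => src f
  | Scale c f => src f
  end.

Fixpoint tgt (t : term) : seq (gen_ob S) :=
  match t with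
  | Id u => u
  | Gen g => gen_tgt g
  | Comp f g => tgt f
  | Tens f g => tgt f ++ tgt g
  | Zero u v => v
  | Add f g => tgt f
  | Scale c f => tgt f
  end.

Fixpoint wf (t : term) : bool :=
  match t with
  | Id _ | Gen _ | Zero _ _ => true
  | Comp f g => [&& wf f, wf g & src f == tgt g]
  | Tens f g => wf f && wf g
  | Add f g => [&& wf f, wf g, src f == src g & tgt f == tgt g]
  | Scale c f => wf f
  end.

Definition typed (u v : seq (gen_ob S)) (t : term) : bool :=
  [&& wf t, src t == u & tgt t == v].

Lemma typedP u v t : reflect [/\ wf t, src t = u & tgt t = v] (typed u v t).
Proof.
by apply: (iffP and3P) => -[wt /eqP su /eqP tv]; split=> //; apply/eqP.
Qed.

Lemma typed_Id u : typed u u (Id u).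
Proof. by rewrite /typed /= !eqxx. Qed.

Lemma typed_Zero u v : typed u v (Zero u v).
Proof. by rewrite /typed /= !eqxx. Qed.

Lemma typed_Gen g : typed (gen_src g) (gen_tgt g) (Gen g).
Proof. by rewrite /typed /= !eqxx. Qed.

Lemma typed_Comp u v w f g :
  typed v w f -> typed u v g -> typed u w (Comp f g).
Proof.
move=> /typedP[wf sf tf] /typedP[wg sg tg]; apply/typedP; split=> //=.
by rewrite wf wg sf tg eqxx.
Qed.

Lemma typed_Tens u v u' v' f g :
  typed u v f -> typed u' v' g -> typed (u ++ u') (v ++ v') (Tens f g).
Proof.
move=> /typedP[wf sf tf] /typedP[wg sg tg]; apply/typedP.
by split; rewrite /= ?wf ?wg ?sf ?sg ?tf ?tg.
Qed.

Lemma typed_Add u v f g : typed u v f -> typed u v g -> typed u v (Add f g).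
Proof.
move=> /typedP[wf sf tf] /typedP[wg sg tg]; apply/typedP; split=> //=.
by rewrite wf wg sf sg tf tg !eqxx.
Qed.

Lemma typed_Scale u v c f : typed u v f -> typed u v (Scale c f).
Proof. by []. Qed.

Lemma typed_bigAdd u v (I : Type) (r : seq I) (P : pred I) (F : I -> term) :
  (forall i, P i -> typed u v (F i)) ->
  typed u v (\big[@Add k S/Zero u v]_(i <- r | P i) F i).
Proof.
move=> tF; elim/big_rec: _ => [|i t Pi tt]; first exact: typed_Zero.
by apply: typed_Add => //; apply: tF.
Qed.

End Typing.

(* [pres_rel_typed] guarantees that no imposed relation is discarded for being
   ill-typed. *)
Record presentation (k : fieldType) := Presentation {
  pres_sig :> signature;
  pres_rel : term k pres_sig -> term k pres_sig -> Prop;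
  pres_rel_typed : forall f g, pres_rel f g ->
    exists u v, typed u v f /\ typed u v g
}.

Section PresentedCategory.
Variables (k : fieldType) (P : presentation k).
Local Notation term := (term k P).
Local Notation word := (seq (gen_ob P)).

(* The congruence generated by the relations of the presentation and the
   axioms of strict k-linear monoidal categories. *)
Inductive eqv : word -> word -> term -> term -> Prop :=
| eqv_refl u v f : typed u v f -> eqv u v f f
| eqv_sym u v f g : eqv u v f g -> eqv u v g f
| eqv_trans u v f g h : eqv u v f g -> eqv u v g h -> eqv u v f h
| eqv_Comp u v w f f' g g' : eqv v w f f' -> eqv u v g g' ->
    eqv u w (f \o g) (f' \o g')
| eqv_Tens u v u' v' f f' g g' : eqv u v f f' -> eqv u' v' g g' ->
    eqv (u ++ u') (v ++ v') (f \ox g) (f' \ox g')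
| eqv_Add u v f f' g g' : eqv u v f f' -> eqv u v g g' ->
    eqv u v (Add f g) (Add f' g')
| eqv_Scale u v c f f' : eqv u v f f' -> eqv u v (Scale c f) (Scale c f')
| eqv_addA u v f g h : typed u v f -> typed u v g -> typed u v h ->
    eqv u v (Add f (Add g h)) (Add (Add f g) h)
| eqv_addC u v f g : typed u v f -> typed u v g ->
    eqv u v (Add f g) (Add g f)
| eqv_add0 u v f : typed u v f -> eqv u v (Add (Zero u v) f) f
| eqv_addN u v f : typed u v f ->
    eqv u v (Add (Scale (- 1) f) f) (Zero u v)
| eqv_scaleA u v c d f : typed u v f ->
    eqv u v (Scale c (Scale d f)) (Scale (c * d) f)
| eqv_scale1 u v f : typed u v f -> eqv u v (Scale 1 f) f
| eqv_scaleDr u v c f g : typed u v f -> typed u v g ->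
    eqv u v (Scale c (Add f g)) (Add (Scale c f) (Scale c g))
| eqv_scaleDl u v c d f : typed u v f ->
    eqv u v (Scale (c + d) f) (Add (Scale c f) (Scale d f))
| eqv_compA u v w x f g h : typed w x f -> typed v w g -> typed u v h ->
    eqv u x (f \o (g \o h)) ((f \o g) \o h)
| eqv_idl u v f : typed u v f -> eqv u v (Id v \o f) f
| eqv_idr u v f : typed u v f -> eqv u v (f \o Id u) f
| eqv_compDl u v w f f' g : typed v w f -> typed v w f' -> typed u v g ->
    eqv u w (Add f f' \o g) (Add (f \o g) (f' \o g))
| eqv_compDr u v w f g g' : typed v w f -> typed u v g -> typed u v g' ->
    eqv u w (f \o Add g g') (Add (f \o g) (f \o g'))
| eqv_compZl u v w c f g : typed v w f -> typed u v g ->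
    eqv u w (Scale c f \o g) (Scale c (f \o g))
| eqv_compZr u v w c f g : typed v w f -> typed u v g ->
    eqv u w (f \o Scale c g) (Scale c (f \o g))
| eqv_tensA u v u' v' u'' v'' f g h :
    typed u v f -> typed u' v' g -> typed u'' v'' h ->
    eqv (u ++ (u' ++ u'')) (v ++ (v' ++ v'')) (f \ox (g \ox h)) ((f \ox g) \ox h)
| eqv_tens1l u v f : typed u v f -> eqv u v (Id [::] \ox f) f
| eqv_tens1r u v f : typed u v f -> eqv u v (f \ox Id [::]) f
| eqv_tens_id u v : eqv (u ++ v) (u ++ v) (Id u \ox Id v) (Id (u ++ v))
| eqv_interchange u v w u' v' w' f g f' g' :
    typed v w f -> typed u v g -> typed v' w' f' -> typed u' v' g' ->
    eqv (u ++ u') (w ++ w')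
      ((f \o g) \ox (f' \o g')) ((f \ox f') \o (g \ox g'))
| eqv_tensDl u v u' v' f f' g : typed u v f -> typed u v f' -> typed u' v' g ->
    eqv (u ++ u') (v ++ v') (Add f f' \ox g) (Add (f \ox g) (f' \ox g))
| eqv_tensDr u v u' v' f g g' : typed u v f -> typed u' v' g -> typed u' v' g' ->
    eqv (u ++ u') (v ++ v') (f \ox Add g g') (Add (f \ox g) (f \ox g'))
| eqv_tensZl u v u' v' c f g : typed u v f -> typed u' v' g ->
    eqv (u ++ u') (v ++ v') (Scale c f \ox g) (Scale c (f \ox g))
| eqv_tensZr u v u' v' c f g : typed u v f -> typed u' v' g ->
    eqv (u ++ u') (v ++ v') (f \ox Scale c g) (Scale c (f \ox g))
| eqv_rel u v f g : pres_rel f g -> typed u v f -> typed u v g -> eqv u v f g.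

Definition typed_term (u v : word) := {t : term | typed u v t}.

HB.instance Definition _ := gen_eqMixin term.
HB.instance Definition _ := gen_choiceMixin term.
HB.instance Definition _ u v := Choice.copy (typed_term u v) {t : term | typed u v t}.

Definition eqvb u v : rel (typed_term u v) :=
  fun f g => `[< eqv u v (sval f) (sval g) >].

Lemma eqvb_refl u v : reflexive (@eqvb u v).
Proof. by move=> [f tf]; apply/asboolP; apply: eqv_refl. Qed.

Lemma eqvb_sym u v : symmetric (@eqvb u v).
Proof. by move=> f g; apply/asboolP/asboolP => /eqv_sym. Qed.

Lemma eqvb_trans u v : transitive (@eqvb u v).
Proof.
by move=> f g h /asboolP gf /asboolP fh; apply/asboolP; apply: eqv_trans gf fh.
Qed.

Canonical eqvb_equiv u v :=
  EquivRel (@eqvb u v) (@eqvb_refl u v) (@eqvb_sym u v) (@eqvb_trans u v).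

Definition pres_hom (u v : word) := {eq_quot @eqvb u v}%qT.

HB.instance Definition _ u v := Choice.on (pres_hom u v).
HB.instance Definition _ u v := EqQuotient.on (pres_hom u v).

Definition cls (u v : word) (f : term) (tf : typed u v f) : pres_hom u v :=
  \pi_(pres_hom u v)%qT (exist _ f tf).

Definition rep (u v : word) (x : pres_hom u v) : term :=
  sval (repr x : typed_term u v).

Lemma rep_typed u v (x : pres_hom u v) : typed u v (rep x).
Proof. exact: (svalP (repr x : typed_term u v)). Qed.

Lemma cls_rep u v (x : pres_hom u v) : cls (rep_typed x) = x.
Proof.
rewrite /cls -[RHS]reprK; congr (\pi_(pres_hom u v)%qT _).
exact: val_inj.
Qed.

Lemma eq_cls u v f g (tf : typed u v f) (tg : typed u v g) :
  eqv u v f g -> cls tf = cls tg.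
Proof. by move=> fg; apply/eqmodP/asboolP. Qed.

Lemma cls_inj u v f g (tf : typed u v f) (tg : typed u v g) :
  cls tf = cls tg -> eqv u v f g.
Proof. by move=> /eqmodP /asboolP. Qed.

Lemma rep_cls u v f (tf : typed u v f) : eqv u v (rep (cls tf)) f.
Proof. by apply: (@cls_inj _ _ _ _ (rep_typed (cls tf)) tf); rewrite cls_rep. Qed.

Lemma cls_ind u v (Q : pres_hom u v -> Prop) :
  (forall f (tf : typed u v f), Q (cls tf)) -> forall x, Q x.
Proof. by move=> Qc x; rewrite -[x]cls_rep. Qed.

Definition hom_add u v (x y : pres_hom u v) : pres_hom u v :=
  cls (typed_Add (rep_typed x) (rep_typed y)).
Definition hom_zero u v : pres_hom u v := cls (typed_Zero k u v).
Definition hom_scale u v (c : k) (x : pres_hom u v) : pres_hom u v :=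
  cls (typed_Scale c (rep_typed x)).
Definition hom_opp u v (x : pres_hom u v) : pres_hom u v := hom_scale (- 1) x.
Definition hom_comp u v w (x : pres_hom v w) (y : pres_hom u v) : pres_hom u w :=
  cls (typed_Comp (rep_typed x) (rep_typed y)).
Definition hom_tens u v u' v' (x : pres_hom u v) (y : pres_hom u' v') :
  pres_hom (u ++ u') (v ++ v') :=
  cls (typed_Tens (rep_typed x) (rep_typed y)).

Lemma hom_addE u v f g (tf : typed u v f) (tg : typed u v g) :
  hom_add (cls tf) (cls tg) = cls (typed_Add tf tg).
Proof. by apply: eq_cls; apply: eqv_Add; apply: rep_cls. Qed.

Lemma hom_scaleE u v c f (tf : typed u v f) :
  hom_scale c (cls tf) = cls (typed_Scale c tf).
Proof. by apply: eq_cls; apply: eqv_Scale; apply: rep_cls. Qed.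

Lemma hom_compE u v w f g (tf : typed v w f) (tg : typed u v g) :
  hom_comp (cls tf) (cls tg) = cls (typed_Comp tf tg).
Proof. by apply: eq_cls; apply: eqv_Comp; apply: rep_cls. Qed.

Lemma hom_tensE u v u' v' f g (tf : typed u v f) (tg : typed u' v' g) :
  hom_tens (cls tf) (cls tg) = cls (typed_Tens tf tg).
Proof. by apply: eq_cls; apply: eqv_Tens; apply: rep_cls. Qed.

Lemma hom_addA u v : associative (@hom_add u v).
Proof.
elim/cls_ind=> f tf; elim/cls_ind=> g tg; elim/cls_ind=> h th.
by rewrite !hom_addE; apply: eq_cls; apply: eqv_addA.
Qed.

Lemma hom_addC u v : commutative (@hom_add u v).
Proof.
elim/cls_ind=> f tf; elim/cls_ind=> g tg.
by rewrite !hom_addE; apply: eq_cls; apply: eqv_addC.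
Qed.

Lemma hom_add0 u v : left_id (hom_zero u v) (@hom_add u v).
Proof.
by elim/cls_ind=> f tf; rewrite hom_addE; apply: eq_cls; apply: eqv_add0.
Qed.

Lemma hom_addN u v : left_inverse (hom_zero u v) (@hom_opp u v) (@hom_add u v).
Proof.
elim/cls_ind=> f tf; rewrite /hom_opp hom_scaleE hom_addE.
by apply: eq_cls; apply: eqv_addN.
Qed.

HB.instance Definition _ u v := GRing.isZmodule.Build (pres_hom u v)
  (@hom_addA u v) (@hom_addC u v) (@hom_add0 u v) (@hom_addN u v).

Lemma hom_scaleA u v c d (x : pres_hom u v) :
  hom_scale c (hom_scale d x) = hom_scale (c * d) x.
Proof.
elim/cls_ind: x => f tf; rewrite !hom_scaleE.
by apply: eq_cls; apply: eqv_scaleA.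
Qed.

Lemma hom_scale1 u v : left_id 1 (@hom_scale u v).
Proof.
by elim/cls_ind=> f tf; rewrite hom_scaleE; apply: eq_cls; apply: eqv_scale1.
Qed.

Lemma hom_scaleDr u v : right_distributive (@hom_scale u v) +%R.
Proof.
move=> c; elim/cls_ind=> f tf; elim/cls_ind=> g tg.
rewrite /GRing.add /= !(hom_scaleE, hom_addE).
by apply: eq_cls; apply: eqv_scaleDr.
Qed.

Lemma hom_scaleDl u v (x : pres_hom u v) :
  {morph (@hom_scale u v)^~ x : c d / c + d}.
Proof.
move=> c d; elim/cls_ind: x => f tf.
rewrite [RHS]/GRing.add /= !(hom_scaleE, hom_addE).
by apply: eq_cls; apply: eqv_scaleDl.
Qed.

HB.instance Definition _ u v := GRing.Zmodule_isLmodule.Build k (pres_hom u v)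
  (@hom_scaleA u v) (@hom_scale1 u v) (@hom_scaleDr u v) (@hom_scaleDl u v).

Lemma cls_add u v f g (tf : typed u v f) (tg : typed u v g) :
  cls tf + cls tg = cls (typed_Add tf tg).
Proof. exact: hom_addE. Qed.

Lemma cls_scale u v c f (tf : typed u v f) :
  c *: cls tf = cls (typed_Scale c tf).
Proof. exact: hom_scaleE. Qed.

Let phom (u v : word) : lmodType k := pres_hom u v.

Lemma pack_cls u v u' v' f g (tf : typed u v f) (tg : typed u' v' g) :
  u = u' -> v = v' -> eqv u v f g ->
  pack (hom := phom) (cls tf) =
  pack (hom := phom) (cls tg).
Proof.
by move=> eu ev; subst u' v' => fg; rewrite (eq_cls tf tg fg).
Qed.

Definition hom_id (u : word) : pres_hom u u := cls (typed_Id k u).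

Lemma hom_compA u v w x (f : pres_hom w x) (g : pres_hom v w)
  (h : pres_hom u v) : hom_comp f (hom_comp g h) = hom_comp (hom_comp f g) h.
Proof.
elim/cls_ind: f => f tf; elim/cls_ind: g => g tg; elim/cls_ind: h => h th.
by rewrite !hom_compE; apply: eq_cls; apply: (@eqv_compA _ v w).
Qed.

Lemma hom_comp_idl u v (f : pres_hom u v) : hom_comp (hom_id v) f = f.
Proof.
by elim/cls_ind: f => f tf; rewrite hom_compE; apply: eq_cls; apply: eqv_idl.
Qed.

Lemma hom_comp_idr u v (f : pres_hom u v) : hom_comp f (hom_id u) = f.
Proof.
by elim/cls_ind: f => f tf; rewrite hom_compE; apply: eq_cls; apply: eqv_idr.
Qed.

Lemma hom_comp_linl u v w (g : pres_hom u v) c (f f' : pres_hom v w) :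
  hom_comp (c *: f + f') g = c *: hom_comp f g + hom_comp f' g.
Proof.
elim/cls_ind: f => f tf; elim/cls_ind: f' => f' tf'; elim/cls_ind: g => g tg.
rewrite cls_scale cls_add !hom_compE cls_scale cls_add; apply: eq_cls.
apply: eqv_trans; first by apply: (@eqv_compDl _ v).
apply: eqv_Add; first by apply: (@eqv_compZl _ v).
by apply: eqv_refl; apply: typed_Comp tg.
Qed.

Lemma hom_comp_linr u v w (f : pres_hom v w) c (g g' : pres_hom u v) :
  hom_comp f (c *: g + g') = c *: hom_comp f g + hom_comp f g'.
Proof.
elim/cls_ind: f => f tf; elim/cls_ind: g => g tg; elim/cls_ind: g' => g' tg'.
rewrite cls_scale cls_add !hom_compE cls_scale cls_add; apply: eq_cls.
apply: eqv_trans; first by apply: (@eqv_compDr _ v).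
apply: eqv_Add; first by apply: (@eqv_compZr _ v).
by apply: eqv_refl; apply: typed_Comp tg'.
Qed.

Lemma hom_tens_id u v : hom_tens (hom_id u) (hom_id v) = hom_id (u ++ v).
Proof. by rewrite hom_tensE; apply: eq_cls; apply: eqv_tens_id. Qed.

Lemma hom_tens_comp u v w u' v' w' (f : pres_hom v w) (g : pres_hom u v)
  (f' : pres_hom v' w') (g' : pres_hom u' v') :
  hom_tens (hom_comp f g) (hom_comp f' g') =
  hom_comp (hom_tens f f') (hom_tens g g').
Proof.
elim/cls_ind: f => f tf; elim/cls_ind: g => g tg.
elim/cls_ind: f' => f' tf'; elim/cls_ind: g' => g' tg'.
by rewrite !(hom_compE, hom_tensE); apply: eq_cls; apply: (@eqv_interchange _ v _ _ v').
Qed.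

Lemma hom_tens_linl u v u' v' (g : pres_hom u' v') c (f f' : pres_hom u v) :
  hom_tens (c *: f + f') g = c *: hom_tens f g + hom_tens f' g.
Proof.
elim/cls_ind: f => f tf; elim/cls_ind: f' => f' tf'; elim/cls_ind: g => g tg.
rewrite cls_scale cls_add !hom_tensE cls_scale cls_add; apply: eq_cls.
apply: eqv_trans; first by apply: eqv_tensDl.
by apply: eqv_Add; [apply: eqv_tensZl | apply: eqv_refl; apply: typed_Tens].
Qed.

Lemma hom_tens_linr u v u' v' (f : pres_hom u v) c (g g' : pres_hom u' v') :
  hom_tens f (c *: g + g') = c *: hom_tens f g + hom_tens f g'.
Proof.
elim/cls_ind: f => f tf; elim/cls_ind: g => g tg; elim/cls_ind: g' => g' tg'.
rewrite cls_scale cls_add !hom_tensE cls_scale cls_add; apply: eq_cls.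
apply: eqv_trans; first by apply: eqv_tensDr.
by apply: eqv_Add; [apply: eqv_tensZr | apply: eqv_refl; apply: typed_Tens].
Qed.

Lemma hom_tensA u v u' v' u'' v''
  (f : pres_hom u v) (g : pres_hom u' v') (h : pres_hom u'' v'') :
  pack (hom := phom) (hom_tens f (hom_tens g h)) =
  pack (hom := phom) (hom_tens (hom_tens f g) h).
Proof.
elim/cls_ind: f => f tf; elim/cls_ind: g => g tg; elim/cls_ind: h => h th.
rewrite !hom_tensE; apply: pack_cls; rewrite ?catA //.
by rewrite -!catA; apply: eqv_tensA.
Qed.

Lemma hom_tens1l u v (f : pres_hom u v) :
  pack (hom := phom) (hom_tens (hom_id [::]) f) = pack (hom := phom) f.
Proof.
elim/cls_ind: f => f tf; rewrite !hom_tensE.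
by apply: pack_cls => //; apply: eqv_tens1l.
Qed.

Lemma hom_tens1r u v (f : pres_hom u v) :
  pack (hom := phom) (hom_tens f (hom_id [::])) = pack (hom := phom) f.
Proof.
elim/cls_ind: f => f tf; rewrite !hom_tensE.
by apply: pack_cls; rewrite ?cats0 //; apply: eqv_tens1r.
Qed.

Definition pres_cat : slmcat k :=
  @SLMCat k word phom hom_id hom_comp [::] cat hom_tens
    hom_compA hom_comp_idl hom_comp_idr hom_comp_linl hom_comp_linr
    (@catA _) (@cat0s _) (@cats0 _) hom_tens_id hom_tens_comp
    hom_tens_linl hom_tens_linr hom_tensA hom_tens1l hom_tens1r.

Definition mor (u v : word) (f : term) (tf : typed u v f) :
  hom (u : pres_cat) v := cls tf.

End PresentedCategory.

Record posnat := PosNat { posnat_val :> nat; posnat_gt0 : (0 < posnat_val)%N }.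
HB.instance Definition _ := [isSub for posnat_val].
HB.instance Definition _ := [Equality of posnat by <:].

Definition pone : posnat := @PosNat 1 isT.

Definition qint (k : fieldType) (q : k) (n : nat) : k :=
  (q ^+ n - q ^- n) / (q - q^-1).
Definition qfact (k : fieldType) (q : k) (a : nat) : k :=
  \prod_(1 <= i < a.+1) qint q i.
Definition qbin (k : fieldType) (q : k) (n a : nat) : k :=
  (\prod_(i < a) qint q (n - i)) / qfact q a.

(* Objects are words in the positive integers; thickness 0 is the empty word. *)
Definition strand (a : nat) : seq posnat :=
  if insub a is Some a' then [:: a'] else [::].

(* [D] indexes the generating dots, of thickness [th]. [WCrossInv a b] and
   [WDotInv i] are the inverses of [WCross a b] and [WDot i]. *)
Inductive web_gen (D : Type) : Type :=
| WMerge of posnat & posnat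
| WSplit of posnat & posnat
| WCross of posnat & posnat
| WCrossInv of posnat & posnat
| WDot of D
| WDotInv of D.

Arguments WMerge {D}.
Arguments WSplit {D}.
Arguments WCross {D}.
Arguments WCrossInv {D}.

Definition web_src (D : Type) (th : D -> posnat) (g : web_gen D) : seq posnat :=
  match g with
  | WMerge a b => [:: a; b]
  | WSplit a b => strand (a + b)
  | WCross a b => [:: a; b]
  | WCrossInv a b => [:: b; a]
  | WDot i => [:: th i]
  | WDotInv i => [:: th i]
  end.

Definition web_tgt (D : Type) (th : D -> posnat) (g : web_gen D) : seq posnat :=
  match g with
  | WMerge a b => strand (a + b)
  | WSplit a b => [:: a; b]
  | WCross a b => [:: b; a]
  | WCrossInv a b => [:: a; b]
  | WDot i => [:: th i]
  | WDotInv i => [:: th i]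
  end.

Definition web_sig (D : Type) (th : D -> posnat) : signature :=
  {| gen_ob := posnat; gen_mor := web_gen D;
     gen_src := web_src th; gen_tgt := web_tgt th |}.

Lemma strand_posnat (a : posnat) : strand a = [:: a].
Proof. by rewrite /strand valK. Qed.

Lemma strand0 : strand 0 = [::].
Proof. by rewrite /strand insubF. Qed.

Variant strand_spec (a : nat) : option posnat -> seq posnat -> Type :=
| StrandPos (a' : posnat) of a = a' : strand_spec a (Some a') [:: a']
| StrandZero of a = 0%N : strand_spec a None [::].

Lemma strandP a : strand_spec a (insub a) (strand a).
Proof.
rewrite /strand; case: insubP => [a' _ <-|]; first by constructor.
by rewrite -eqn0Ngt => /eqP ->; constructor.
Qed.

Section WebTerms.
Variables (k : fieldType) (D : Type) (th : D -> posnat).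
Local Notation term := (term k (web_sig th)).
Local Notation gen g := (@Gen k (web_sig th) g).
Local Notation typed := (@typed k (web_sig th)).

Definition idt (a : nat) : term := @Id k (web_sig th) (strand a).

(* Merges, splits and crossings involving thickness 0 are identities. *)
Definition wmerge (a b : nat) : term :=
  match insub a, insub b with
  | Some a', Some b' => gen (WMerge a' b')
  | _, _ => idt (a + b)
  end.

Definition wsplit (a b : nat) : term :=
  match insub a, insub b with
  | Some a', Some b' => gen (WSplit a' b')
  | _, _ => idt (a + b)
  end.

Definition wcross (a b : nat) : term :=
  match insub a, insub b with
  | Some a', Some b' => gen (WCross a' b')
  | _, _ => idt (a + b)
  end.

Definition wcross_inv (a b : nat) : term :=
  match insub a, insub b with
  | Some a', Some b' => gen (WCrossInv a' b')
  | _, _ => idt (a + b)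
  end.

Fixpoint imerge (s : seq nat) : term :=
  if s is a :: s' then (wmerge a (sumn s') \o (idt a \ox imerge s'))%T else idt 0.

Fixpoint isplit (s : seq nat) : term :=
  if s is a :: s' then ((idt a \ox isplit s') \o wsplit a (sumn s'))%T else idt 0.

Definition tpow (f : term) (n : nat) : term := iter n (Tens f) (idt 0).

Lemma typed_idt a : typed (strand a) (strand a) (idt a).
Proof. exact: typed_Id. Qed.

Lemma typed_merge a b :
  typed (strand a ++ strand b) (strand (a + b)) (wmerge a b).
Proof.
rewrite /wmerge; case: (strandP a) => [a' ea|ea];
  case: (strandP b) => [b' eb|eb];
  by rewrite /typed /= ?ea ?eb ?addn0 ?add0n ?strand_posnat ?strand0 ?eqxx.
Qed.

Lemma typed_split a b :
  typed (strand (a + b)) (strand a ++ strand b) (wsplit a b).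
Proof.
rewrite /wsplit; case: (strandP a) => [a' ea|ea];
  case: (strandP b) => [b' eb|eb];
  by rewrite /typed /= ?ea ?eb ?addn0 ?add0n ?strand_posnat ?strand0 ?eqxx.
Qed.

Lemma typed_cross a b :
  typed (strand a ++ strand b) (strand b ++ strand a) (wcross a b).
Proof.
rewrite /wcross; case: (strandP a) => [a' ea|ea];
  case: (strandP b) => [b' eb|eb];
  by rewrite /typed /= ?ea ?eb ?addn0 ?add0n ?strand_posnat ?strand0 ?eqxx.
Qed.

Lemma typed_cross_inv a b :
  typed (strand b ++ strand a) (strand a ++ strand b) (wcross_inv a b).
Proof.
rewrite /wcross_inv; case: (strandP a) => [a' ea|ea];
  case: (strandP b) => [b' eb|eb];
  by rewrite /typed /= ?ea ?eb ?addn0 ?add0n ?strand_posnat ?strand0 ?eqxx.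
Qed.

Lemma typed_imerge s :
  typed (flatten (map strand s)) (strand (sumn s)) (imerge s).
Proof.
elim: s => [|a s IHs] /=; first by rewrite /typed /= strand0.
apply: (@typed_Comp k (web_sig th) _ (strand a ++ strand (sumn s)));
  first exact: typed_merge.
by apply: typed_Tens => //; apply: typed_idt.
Qed.

Lemma typed_isplit s :
  typed (strand (sumn s)) (flatten (map strand s)) (isplit s).
Proof.
elim: s => [|a s IHs] /=; first by rewrite /typed /= strand0.
apply: (@typed_Comp k (web_sig th) _ (strand a ++ strand (sumn s)));
  last exact: typed_split.
by apply: typed_Tens => //; apply: typed_idt.
Qed.

Lemma typed_tpow a f n : typed (strand a) (strand a) f ->
  typed (flatten (map strand (nseq n a))) (flatten (map strand (nseq n a)))
        (tpow f n).
Proof.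
move=> tf; elim: n => [|n IHn] /=; first by rewrite /typed /= strand0.
exact: typed_Tens.
Qed.

(* m_{1^a} f^{\otimes a} s_{1^a} *)
Definition thicken (f : term) (a : nat) : term :=
  (imerge (nseq a 1%N) \o (tpow f a \o isplit (nseq a 1%N)))%T.

Lemma typed_thicken f a : typed (strand 1) (strand 1) f ->
  typed (strand a) (strand a) (thicken f a).
Proof.
move=> tf; have e : sumn (nseq a 1%N) = a by rewrite sumn_nseq mul1n.
rewrite /thicken -{1 2}e; apply: typed_Comp; first exact: typed_imerge.
apply: typed_Comp; last exact: typed_isplit.
exact: typed_tpow.
Qed.

Variable q : k.

Definition square_summand (a b c d s t : nat) : term :=
  Scale (q ^+ (s * t))
    ((wmerge s (b - s) \ox wmerge (a - s) t)
     \o ((idt s \ox wcross (a - s) (c - t) \ox idt t)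
     \o (wsplit s (a - s) \ox wsplit (c - t) t)))%T.

Definition square_sum (a b c d : nat) : term :=
  let zero := @Zero k (web_sig th) (strand a ++ strand c) (strand b ++ strand d) in
  \big[@Add k (web_sig th)/zero]_(s < (minn a b).+1)
    \big[@Add k (web_sig th)/zero]_(t < (minn c d).+1 | (t + a == s + d)%N)
      square_summand a b c d s t.

Lemma typed_square_summand a b c d s t : (a + c = b + d)%N ->
  (s <= minn a b)%N -> (t <= minn c d)%N -> (t + a = s + d)%N ->
  typed (strand a ++ strand c) (strand b ++ strand d)
    (square_summand a b c d s t).
Proof.
rewrite !leq_min => eacbd /andP[sa sb] /andP[tc td] etasd.
have ect : (c - t = b - s)%N by lia.
have edt : (a - s + t = d)%N by lia.
apply: typed_Scale.
have tm := typed_Tens (typed_merge s (b - s)) (typed_merge (a - s) t).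
have tc' := typed_Tens
  (typed_Tens (typed_idt s) (typed_cross (a - s) (c - t))) (typed_idt t).
have ts := typed_Tens (typed_split s (a - s)) (typed_split (c - t) t).
rewrite subnKC // edt -!catA in tm; rewrite -!catA {2}ect in tc'.
rewrite subnKC // subnK // -!catA in ts.
exact: typed_Comp tm (typed_Comp tc' ts).
Qed.

Lemma typed_square_sum a b c d : (a + c = b + d)%N ->
  typed (strand a ++ strand c) (strand b ++ strand d) (square_sum a b c d).
Proof.
move=> e; apply: typed_bigAdd => -[s hs] _; apply: typed_bigAdd => -[t ht] /= /eqP.
exact: typed_square_summand.
Qed.

Inductive common_rel : term -> term -> Prop :=
| merge_assoc (a b c : posnat) : common_rel
    (wmerge (a + b) c \o (wmerge a b \ox idt c))
    (wmerge a (b + c) \o (idt a \ox wmerge b c))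
| split_assoc (a b c : posnat) : common_rel
    ((wsplit a b \ox idt c) \o wsplit (a + b) c)
    ((idt a \ox wsplit b c) \o wsplit a (b + c))
| square (a b c d : posnat) : (a + c = b + d)%N -> common_rel
    (wsplit b d \o wmerge a c) (square_sum a b c d)
| digon (a b : posnat) : common_rel
    (wmerge a b \o wsplit a b) (Scale (qbin q (a + b) a) (idt (a + b)))
| cross_invl (a b : posnat) : common_rel
    (wcross_inv a b \o wcross a b) (idt a \ox idt b)
| cross_invr (a b : posnat) : common_rel
    (wcross a b \o wcross_inv a b) (idt b \ox idt a)
| dot_invl (i : D) : common_rel
    (gen (WDotInv i) \o gen (WDot i)) (idt (th i))
| dot_invr (i : D) : common_rel
    (gen (WDot i) \o gen (WDotInv i)) (idt (th i)).

Lemma typed_dot i : typed (strand (th i)) (strand (th i)) (gen (WDot i)).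
Proof. by rewrite strand_posnat; apply: typed_Gen. Qed.

Lemma typed_dot_inv i : typed (strand (th i)) (strand (th i)) (gen (WDotInv i)).
Proof. by rewrite strand_posnat; apply: typed_Gen. Qed.

Lemma common_rel_typed f g : common_rel f g ->
  exists u v, typed u v f /\ typed u v g.
Proof.
case=> [a b c|a b c|a b c d e|a b|a b|a b|i|i].
- exists ((strand a ++ strand b) ++ strand c), (strand (a + b + c)); split.
    by apply: typed_Comp (typed_merge _ _) (typed_Tens (typed_merge _ _) (typed_idt _)).
  rewrite -catA -addnA.
  by apply: typed_Comp (typed_merge _ _) (typed_Tens (typed_idt _) (typed_merge _ _)).
- exists (strand (a + b + c)), ((strand a ++ strand b) ++ strand c); split.
    by apply: typed_Comp (typed_Tens (typed_split _ _) (typed_idt _)) (typed_split _ _).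
  rewrite -catA -addnA.
  by apply: typed_Comp (typed_Tens (typed_idt _) (typed_split _ _)) (typed_split _ _).
- exists (strand a ++ strand c), (strand b ++ strand d); split.
    by apply: typed_Comp (typed_split _ _) _; rewrite -e; apply: typed_merge.
  exact: typed_square_sum.
- exists (strand (a + b)), (strand (a + b)); split; last exact: typed_idt.
  by apply: typed_Comp (typed_merge _ _) (typed_split _ _).
- exists (strand a ++ strand b), (strand a ++ strand b); split.
    by apply: typed_Comp (typed_cross_inv _ _) (typed_cross _ _).
  by apply: typed_Tens; apply: typed_idt.
- exists (strand b ++ strand a), (strand b ++ strand a); split.
    by apply: typed_Comp (typed_cross _ _) (typed_cross_inv _ _).
  by apply: typed_Tens; apply: typed_idt.
- exists (strand (th i)), (strand (th i)); split; last exact: typed_idt.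
  by apply: typed_Comp (typed_dot_inv _) (typed_dot _).
- exists (strand (th i)), (strand (th i)); split; last exact: typed_idt.
  by apply: typed_Comp (typed_dot _) (typed_dot_inv _).
Qed.

End WebTerms.

(* The sets of dots are {x_1} for Web^{\bullet\prime} and {x_a : a >= 1} for
   Web^\bullet. *)
Definition thick1 (i : unit) : posnat := pone.
Definition web'_sig : signature := web_sig thick1.
Definition webdot_sig : signature := web_sig (@id posnat).

Section Webs.
Variables (k : fieldType) (q : k).

Definition dot1 : term k web'_sig := @Gen k web'_sig (WDot tt).
Definition dot1_inv : term k web'_sig := @Gen k web'_sig (WDotInv tt).

Inductive web'_rel : term k web'_sig -> term k web'_sig -> Prop :=
| web'_common f g : common_rel q f g -> web'_rel f g
| web'_dot_slide1 : web'_rel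
    (wcross k thick1 1 1 \o (dot1 \ox idt k thick1 1))
    ((idt k thick1 1 \ox dot1) \o wcross_inv k thick1 1 1)
| web'_dot_slide2 : web'_rel
    ((dot1 \ox idt k thick1 1) \o wcross k thick1 1 1)
    (wcross_inv k thick1 1 1 \o (idt k thick1 1 \ox dot1)).

Local Notation wm := (wmerge k (@id posnat)).
Local Notation ws := (wsplit k (@id posnat)).
Local Notation wc := (wcross k (@id posnat)).
Local Notation wc' := (wcross_inv k (@id posnat)).
Local Notation w1 := (idt k (@id posnat)).

Definition dot (a : nat) : term k webdot_sig :=
  if insub a is Some a' then @Gen k webdot_sig (WDot a') else w1 0.

Definition dot_inv (a : nat) : term k webdot_sig :=
  if insub a is Some a' then @Gen k webdot_sig (WDotInv a') else w1 0.

Inductive webdot_rel : term k webdot_sig -> term k webdot_sig -> Prop :=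
| webdot_common f g : common_rel q f g -> webdot_rel f g
| dot_slide1 (a b : posnat) : webdot_rel
    (wc a b \o (dot a \ox w1 b)) ((w1 b \ox dot a) \o wc' b a)
| dot_slide2 (a b : posnat) : webdot_rel
    ((dot b \ox w1 a) \o wc a b) (wc' b a \o (w1 a \ox dot b))
| dot_split (a b : posnat) : webdot_rel
    (ws a b \o dot (a + b)) ((dot a \ox dot b) \o ws a b)
| dot_merge (a b : posnat) : webdot_rel
    (dot (a + b) \o wm a b) (wm a b \o (dot a \ox dot b))
| dot_thicken (a : posnat) : webdot_rel
    (thicken (dot 1) a) (Scale (qfact q a) (dot a))
| dot_inv_thicken (a : posnat) : webdot_rel
    (thicken (dot_inv 1) a) (Scale (qfact q a) (dot_inv a)).

Lemma typed_dot1 : @typed k web'_sig (strand 1) (strand 1) dot1.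
Proof. exact: (typed_dot k thick1 tt). Qed.

Lemma typed_dot1_inv : @typed k web'_sig (strand 1) (strand 1) dot1_inv.
Proof. exact: (typed_dot_inv k thick1 tt). Qed.

Lemma typed_webdot a : @typed k webdot_sig (strand a) (strand a) (dot a).
Proof.
rewrite /dot; case: (strandP a) => [a' _|_]; first exact: typed_Gen.
by rewrite /typed /= strand0.
Qed.

Lemma typed_webdot_inv a : @typed k webdot_sig (strand a) (strand a) (dot_inv a).
Proof.
rewrite /dot_inv; case: (strandP a) => [a' _|_]; first exact: typed_Gen.
by rewrite /typed /= strand0.
Qed.

Lemma web'_rel_typed f g : web'_rel f g ->
  exists u v, typed u v f /\ typed u v g.
Proof.
have ti := typed_idt k thick1 1; have t1 := typed_dot1.
have tc := typed_cross k thick1 1 1; have tc' := typed_cross_inv k thick1 1 1.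
case=> [{}f {}g /common_rel_typed //||];
  exists (strand 1 ++ strand 1), (strand 1 ++ strand 1); split.
- exact: typed_Comp tc (typed_Tens t1 ti).
- exact: typed_Comp (typed_Tens ti t1) tc'.
- exact: typed_Comp (typed_Tens t1 ti) tc.
- exact: typed_Comp tc' (typed_Tens ti t1).
Qed.

Lemma webdot_rel_typed f g : webdot_rel f g ->
  exists u v, typed u v f /\ typed u v g.
Proof.
pose th := @id posnat; pose ti := typed_idt k th.
pose tm := typed_merge k th; pose ts := typed_split k th.
pose tc := typed_cross k th; pose tc' := typed_cross_inv k th.
pose td := typed_webdot; pose td' := typed_webdot_inv.
case=> [{}f {}g /common_rel_typed //|a b|a b|a b|a b|a|a].
- exists (strand a ++ strand b), (strand b ++ strand a); split.
    exact: typed_Comp (tc _ _) (typed_Tens (td _) (ti _)).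
  exact: typed_Comp (typed_Tens (ti _) (td _)) (tc' _ _).
- exists (strand a ++ strand b), (strand b ++ strand a); split.
    exact: typed_Comp (typed_Tens (td _) (ti _)) (tc _ _).
  exact: typed_Comp (tc' _ _) (typed_Tens (ti _) (td _)).
- exists (strand (a + b)), (strand a ++ strand b); split.
    exact: typed_Comp (ts _ _) (td _).
  exact: typed_Comp (typed_Tens (td _) (td _)) (ts _ _).
- exists (strand a ++ strand b), (strand (a + b)); split.
    exact: typed_Comp (td _) (tm _ _).
  exact: typed_Comp (tm _ _) (typed_Tens (td _) (td _)).
- exists (strand a), (strand a); split; last exact: td.
  by apply: typed_thicken; apply: td.
- exists (strand a), (strand a); split; last exact: td'.
  by apply: typed_thicken; apply: td'.
Qed.

Definition web'_pres : presentation k := Presentation web'_rel_typed.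
Definition webdot_pres : presentation k := Presentation webdot_rel_typed.

Definition Web' : slmcat k := pres_cat web'_pres.
Definition Web : slmcat k := pres_cat webdot_pres.

End Webs.

Definition Cq (R : realType) : fieldType := {fraction {poly R[i]}}.
Definition qvar (R : realType) : Cq R := FracField.tofrac ('X : {poly R[i]}).

Section WebsOverCq.
Variable R : realType.
Let q := qvar R.

Definition WebC' : slmcat (Cq R) := Web' q.
Definition WebC : slmcat (Cq R) := Web q.

Definition web'_m (a b : nat) := mor (P := web'_pres q) (typed_merge _ thick1 a b).
Definition web'_s (a b : nat) := mor (P := web'_pres q) (typed_split _ thick1 a b).
Definition web'_c (a b : nat) := mor (P := web'_pres q) (typed_cross _ thick1 a b).
Definition web'_x1 := mor (P := web'_pres q) (typed_dot1 (Cq R)).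
Definition web'_x (a : nat) := mor (P := web'_pres q)
  (typed_Scale (qfact q a)^-1 (typed_thicken a (typed_dot1 (Cq R)))).
Definition web'_xinv (a : nat) := mor (P := web'_pres q)
  (typed_Scale (qfact q a)^-1 (typed_thicken a (typed_dot1_inv (Cq R)))).

Definition web_m (a b : nat) := mor (P := webdot_pres q) (typed_merge _ (@id posnat) a b).
Definition web_s (a b : nat) := mor (P := webdot_pres q) (typed_split _ (@id posnat) a b).
Definition web_c (a b : nat) := mor (P := webdot_pres q) (typed_cross _ (@id posnat) a b).
Definition web_x (a : nat) := mor (P := webdot_pres q) (typed_webdot (Cq R) a).
Definition web_xinv (a : nat) := mor (P := webdot_pres q) (typed_webdot_inv (Cq R) a).

End WebsOverCq.

(* Main.v *)
Require Import Defs.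
From HB Require Import structures.
From mathcomp Require Import all_boot all_order all_algebra.
From mathcomp Require Import boolp reals.
From mathcomp Require Import complex zify.

Set Implicit Arguments.
Unset Strict Implicit.
Unset Printing Implicit Defensive.

Import GRing.Theory.
Local Open Scope ring_scope.

(** The two categories have the same generators except for the thick dots, so
the point is that in the smaller one the webs
x_a = (1/[a]!) m_{1^a} x_1^{\otimes a} s_{1^a} are invertible and satisfy every
relation imposed on thick dots. Once this is known, substituting x_1 for x_1 in
one direction and these webs for the dots in the other respects all relations,
and the two substitutions are inverse to each other on generators, hence
everywhere ([tmap_isomorphism]).

Dots pass merges and splits. The relation c x_1 c = 1 \ox x_1, for c the
crossing of two thin strands, makes x_1 \ox x_1 commute with c. By the square
relation s_{1,n} m_{1,n} is a combination of the identity and of a web that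
contains c and smaller merges and splits, so by induction it commutes with
x_1 \ox x_n ([thick_comm]). As m_{1,n} s_{1,n} is the invertible scalar [n+1],
the dots pass through m_{1,n} and s_{1,n}, then through all merges and splits
([thick_merge], [split_thick]). It also follows that f |-> x_a(f) is
multiplicative ([thick_cmp]), so that the web built from x_1^{-1} is inverse to
the one built from x_1.

Dots pass crossings. The claim is c_{a,b} (x_a \ox 1) c_{b,a} = 1 \ox x_a
([dot_slide]); it reduces to thin strands once crossings are known to slide
through merges and splits with a thin leg ([cr_nat]). This naturality is not a
defining relation. It is proved by induction on a + b: the two associative
ways to write the threefold merge of a, 1 and b, followed by a split, are
expanded with the square relation; by induction the summands agree in pairs,
except for one on each side, and these two are the sides of the identity that is
wanted ([cr_natl_step]). Reflecting diagrams left-right or upside down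
preserves the relations used, so that one computation gives all four forms of
naturality.

Equations are computed in a set of diagrams with total operations ([diagcat]),
where objects that are equal without being convertible cause no trouble. *)

(** * Untyped diagrams *)

(** Morphisms of all types are elements of one set, so that equations between
them need no transport along equalities of objects. The operations are total;
in the model below, an ill-typed composite or sum is an undefined value that
has no type. The element [nul] is not the zero morphism of some type but a
formal zero, neutral for addition and absorbing for composition and tensor: it
makes [add] a commutative monoid law, so that sums may have any index set. The
laws that mention [ty] are those that fail for ill-typed diagrams. *)
Record diagcat (k : fieldType) := DiagCat {
  diag :> Type;
  wd : Type;
  wd1 : wd;
  mulw : wd -> wd -> wd;
  ty : wd -> wd -> diag -> Prop;
  nul : diag;
  add : diag -> diag -> diag;
  scl : k -> diag -> diag;
  idn : wd -> diag;
  cmp : diag -> diag -> diag;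
  tns : diag -> diag -> diag;
  mulwA : associative mulw;
  mul1w : left_id wd1 mulw;
  mulw1 : right_id wd1 mulw;
  addA : associative add;
  addC : commutative add;
  add0 : left_id nul add;
  add_cancel : forall u v x y z, ty u v x -> ty u v y -> ty u v (add x z) ->
    add x z = add y z -> x = y;
  scl1 : forall x, scl 1 x = x;
  sclA : forall c d x, scl c (scl d x) = scl (c * d) x;
  scl_nul : forall c, scl c nul = nul;
  sclD : forall c, {morph scl c : x y / add x y};
  cmpA : associative cmp;
  cmp_null : left_zero nul cmp;
  cmp_nulr : right_zero nul cmp;
  cmpDl : left_distributive cmp add;
  cmpDr : right_distributive cmp add;
  cmpZl : forall c f g, cmp (scl c f) g = scl c (cmp f g);
  cmpZr : forall c f g, cmp f (scl c g) = scl c (cmp f g);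
  tnsA : associative tns;
  tns_null : left_zero nul tns;
  tns_nulr : right_zero nul tns;
  tnsDl : left_distributive tns add;
  tnsDr : right_distributive tns add;
  tnsZl : forall c f g, tns (scl c f) g = scl c (tns f g);
  tnsZr : forall c f g, tns f (scl c g) = scl c (tns f g);
  idn_cmp : forall u v f, ty u v f -> cmp (idn v) f = f;
  cmp_idn : forall u v f, ty u v f -> cmp f (idn u) = f;
  idn1_tns : forall f, tns (idn wd1) f = f;
  tns_idn1 : forall f, tns f (idn wd1) = f;
  idnM : forall u v, idn (mulw u v) = tns (idn u) (idn v);
  idn_tns_cmp : forall u f g,
    tns (idn u) (cmp f g) = cmp (tns (idn u) f) (tns (idn u) g);
  cmp_tns_idn : forall u f g,
    tns (cmp f g) (idn u) = cmp (tns f (idn u)) (tns g (idn u));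
  interchange : forall u v w u' v' w' f g f' g',
    ty v w f -> ty u v g -> ty v' w' f' -> ty u' v' g' ->
    tns (cmp f g) (cmp f' g') = cmp (tns f f') (tns g g');
  ty_idn : forall u, ty u u (idn u);
  ty_cmp : forall u v w f g, ty v w f -> ty u v g -> ty u w (cmp f g);
  ty_tns : forall u v u' v' f g,
    ty u v f -> ty u' v' g -> ty (mulw u u') (mulw v v') (tns f g);
  ty_add : forall u v f g, ty u v f -> ty u v g -> ty u v (add f g);
  ty_scl : forall u v c f, ty u v f -> ty u v (scl c f)
}.
Arguments nul {k _}.
Arguments wd1 {k _}.
Arguments ty {k _}.

HB.instance Definition _ (k : fieldType) (C : diagcat k) :=
  Monoid.isComLaw.Build C nul (@add k C) (@addA k C) (@addC k C) (@add0 k C).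

(** Reflection in a vertical axis, and [flip_cat] in a horizontal one, let a single
computation prove a statement together with its mirror images. *)
Definition mirror_cat (k : fieldType) (C : diagcat k) : diagcat k.
Proof.
refine (@DiagCat k C (wd C) wd1 (fun u v => mulw v u) ty nul (@add k C)
  (@scl k C) (@idn k C) (@cmp k C) (fun f g => tns g f)
  _ _ _ _ _ _ _ _ _ _ _ _ _ _ _ _ _ _ _ _ _ _ _ _ _ _ _ _ _ _ _ _ _ _ _ _ _ _).
- by move=> u v w; rewrite mulwA.
- exact: mulw1.
- exact: mul1w.
- exact: addA.
- exact: addC.
- exact: add0.
- exact: add_cancel.
- exact: scl1.
- exact: sclA.
- exact: scl_nul.
- exact: sclD.
- exact: cmpA.
- exact: cmp_null.
- exact: cmp_nulr.
- exact: cmpDl.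
- exact: cmpDr.
- exact: cmpZl.
- exact: cmpZr.
- by move=> u v w; rewrite tnsA.
- exact: tns_nulr.
- exact: tns_null.
- by move=> f g h; rewrite tnsDr.
- by move=> f g h; rewrite tnsDl.
- by move=> c f g; rewrite tnsZr.
- by move=> c f g; rewrite tnsZl.
- exact: idn_cmp.
- exact: cmp_idn.
- exact: tns_idn1.
- exact: idn1_tns.
- by move=> u v; rewrite idnM.
- by move=> u f g; rewrite cmp_tns_idn.
- by move=> u f g; rewrite idn_tns_cmp.
- by move=> u v w u' v' w' f g f' g' tf tg tf' tg'; rewrite (interchange tf' tg' tf tg).
- exact: ty_idn.
- exact: ty_cmp.
- by move=> u v u' v' f g tf tg; apply: ty_tns.
- exact: ty_add.
- exact: ty_scl.
Defined.

Definition flip_cat (k : fieldType) (C : diagcat k) : diagcat k.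
Proof.
refine (@DiagCat k C (wd C) wd1 (@mulw k C) (fun u v => ty v u) nul (@add k C)
  (@scl k C) (@idn k C) (fun f g => cmp g f) (@tns k C)
  _ _ _ _ _ _ _ _ _ _ _ _ _ _ _ _ _ _ _ _ _ _ _ _ _ _ _ _ _ _ _ _ _ _ _ _ _ _).
- exact: mulwA.
- exact: mul1w.
- exact: mulw1.
- exact: addA.
- exact: addC.
- exact: add0.
- by move=> u v; apply: add_cancel.
- exact: scl1.
- exact: sclA.
- exact: scl_nul.
- exact: sclD.
- by move=> f g h; rewrite cmpA.
- exact: cmp_nulr.
- exact: cmp_null.
- by move=> f g h; rewrite cmpDr.
- by move=> f g h; rewrite cmpDl.
- by move=> c f g; rewrite cmpZr.
- by move=> c f g; rewrite cmpZl.
- exact: tnsA.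
- exact: tns_null.
- exact: tns_nulr.
- exact: tnsDl.
- exact: tnsDr.
- exact: tnsZl.
- exact: tnsZr.
- by move=> u v f tf; rewrite (cmp_idn tf).
- by move=> u v f tf; rewrite (idn_cmp tf).
- exact: idn1_tns.
- exact: tns_idn1.
- exact: idnM.
- by move=> u f g; rewrite idn_tns_cmp.
- by move=> u f g; rewrite cmp_tns_idn.
- by move=> u v w u' v' w' f g f' g' tf tg tf' tg'; rewrite (interchange tg tf tg' tf').
- exact: ty_idn.
- by move=> u v w f g tf tg; apply: ty_cmp tg tf.
- by move=> u v u' v' f g tf tg; apply: ty_tns.
- by move=> u v f g tf tg; apply: ty_add.
- by move=> u v c f tf; apply: ty_scl.
Defined.

Declare Scope diag_scope.
Delimit Scope diag_scope with D.
Notation "f \bo g" := (cmp f g) (at level 44, right associativity) : diag_scope.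
Notation "f \ox g" := (tns f g) : diag_scope.
Notation "f \+ g" := (add f g) : diag_scope.
Notation "c \: f" := (scl c f) (at level 45, right associativity) : diag_scope.

(** * The diagrams of a presented category *)

Section PresentedDiagrams.
Local Open Scope quotient_scope.
Variables (k : fieldType) (P : presentation k).
Local Notation term := (term k P).
Local Notation word := (seq (gen_ob P)).

Lemma eqv_typed (u v : word) (f g : term) :
  eqv u v f g -> typed u v f /\ typed u v g.
Proof.
elim=> {u v f g}; intros; repeat match goal with
  | h : _ /\ _ |- _ => destruct h
  end; split; eauto 4 using typed_Tens, typed_Add, typed_Scale, typed_Id,
    typed_Zero, typed_Comp with nocore.
  by rewrite !catA; apply: typed_Tens => //; apply: typed_Tens.
by rewrite -[u]cats0 -[v]cats0; apply: typed_Tens => //; apply: typed_Id.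
Qed.

Lemma typed_src_tgt (f : term) : wf f -> typed (src f) (tgt f) f.
Proof. by move=> wf_f; apply/typedP. Qed.

(** All ill-typed terms are identified: their class is the undefined value. *)
Definition teq (f g : term) : Prop := wf f = wf g /\ (wf f -> eqv (src f) (tgt f) f g).

Lemma teq_refl f : teq f f.
Proof. by split=> // /typed_src_tgt; apply: eqv_refl. Qed.

Lemma teq_sym f g : teq f g -> teq g f.
Proof.
case=> e fg; split=> // wg; have {}fg := fg (etrans e wg).
have [_ /typedP[_ -> ->]] := eqv_typed fg; exact: eqv_sym.
Qed.

Lemma teq_trans f g h : teq f g -> teq g h -> teq f h.
Proof.
case=> e fg [e' gh]; split=> [|wf_f]; first by rewrite e.
have {}fg := fg wf_f; apply: (eqv_trans fg).
have [_ /typedP[wg <- <-]] := eqv_typed fg; exact: gh.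
Qed.

Lemma teq_of_eqv u v f g : eqv u v f g -> teq f g.
Proof.
move=> fg; have [/typedP[wf_f sf tf] /typedP[wg _ _]] := eqv_typed fg.
by split=> [|_]; rewrite ?wf_f ?wg // sf tf.
Qed.

Lemma teq_wf f g : teq f g -> wf f -> [/\ wf g, src g = src f & tgt g = tgt f].
Proof. by case=> _ fg /fg /eqv_typed[_ /typedP]. Qed.

(** [None] is the formal zero [nul]. *)
Definition oteq (f g : option term) : Prop :=
  match f, g with
  | Some f, Some g => teq f g
  | None, None => True
  | _, _ => False
  end.

Definition oteqb : rel (option term) := fun f g => `[< oteq f g >].

Lemma oteqb_refl : reflexive oteqb.
Proof. by case=> [f|]; apply/asboolP => //=; apply: teq_refl. Qed.

Lemma oteqb_sym : symmetric oteqb.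
Proof.
by move=> [f|] [g|] //; apply/asboolP/asboolP => //=; apply: teq_sym.
Qed.

Lemma oteqb_trans : transitive oteqb.
Proof.
move=> [g|] [f|] [h|] // /asboolP fg /asboolP gh; apply/asboolP => //=.
exact: teq_trans fg gh.
Qed.

Canonical oteqb_equiv := EquivRel oteqb oteqb_refl oteqb_sym oteqb_trans.

Definition tdiag := {eq_quot oteqb}.
Definition ev (f : term) : tdiag := \pi_tdiag (Some f).
Definition ev0 : tdiag := \pi_tdiag None.

Lemma diag_ind (Q : tdiag -> Prop) : Q ev0 -> (forall f, Q (ev f)) -> forall x, Q x.
Proof. by move=> Q0 Qe x; rewrite -[x]reprK; case: (repr x). Qed.

Lemma ev_eq f g : teq f g -> ev f = ev g.
Proof. by move=> fg; apply/eqmodP/asboolP. Qed.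

Lemma ev_eqv u v f g : eqv u v f g -> ev f = ev g.
Proof. by move/teq_of_eqv/ev_eq. Qed.

Lemma ev_inj f g : ev f = ev g -> teq f g.
Proof. by move/eqmodP/asboolP. Qed.

(** Between typed terms, equality of diagrams is the congruence of the
presentation: equations proved for diagrams come back as relations. *)
Lemma ev_eqvP u v f g : typed u v f -> ev f = ev g -> eqv u v f g.
Proof. by case/typedP => wf_f sf tf /ev_inj[_]; rewrite -sf -tf; apply. Qed.

Lemma repr_ev0 : repr ev0 = None.
Proof.
have : \pi_tdiag (repr ev0) = \pi_tdiag None by rewrite reprK.
by move/eqmodP/asboolP; case: (repr ev0).
Qed.

Lemma repr_ev f : exists2 g, repr (ev f) = Some g & teq g f.
Proof.
have : \pi_tdiag (repr (ev f)) = \pi_tdiag (Some f) by rewrite reprK.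
by move/eqmodP/asboolP; case: (repr (ev f)) => // g; exists g.
Qed.

Definition lift2 (c : term -> term -> term) (x y : tdiag) : tdiag :=
  if repr x is Some f then if repr y is Some g then ev (c f g) else ev0 else ev0.

Lemma lift2_0l c : left_zero ev0 (lift2 c).
Proof. by move=> x; rewrite /lift2 repr_ev0. Qed.

Lemma lift2_0r c : right_zero ev0 (lift2 c).
Proof. by move=> x; rewrite /lift2 repr_ev0; case: (repr x). Qed.

Lemma lift2E c f g :
  (forall f f' g g', teq f f' -> teq g g' -> teq (c f g) (c f' g')) ->
  lift2 c (ev f) (ev g) = ev (c f g).
Proof.
move=> hc; rewrite /lift2; have [f' -> ef] := repr_ev f; have [g' -> eg] := repr_ev g.
by apply: ev_eq; apply: hc.
Qed.

Definition dcmp := lift2 (@Comp k P).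
Definition dtns := lift2 (@Tens k P).
Definition dadd (x y : tdiag) : tdiag :=
  match repr x, repr y with
  | None, _ => y
  | _, None => x
  | Some f, Some g => ev (Add f g)
  end.
Definition dscl c (x : tdiag) : tdiag :=
  if repr x is Some f then ev (Scale c f) else ev0.
Definition didn (u : word) : tdiag := ev (Id u).
Definition dty (u v : word) (x : tdiag) : Prop := exists2 f, typed u v f & x = ev f.

Lemma dcmpE f g : dcmp (ev f) (ev g) = ev (f \o g)%T.
Proof.
apply: lift2E => {}f f' {}g g' ff gg; split=> /= [|/and3P[wf_f wg /eqP e]].
  case: ff gg => e1 h1 [e2 h2]; rewrite -e1 -e2.
  have [/= w1|//] := boolP (wf f); have [/= w2|//] := boolP (wf g).
  have [_ /typedP[_ -> _]] := eqv_typed (h1 w1).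
  by have [_ /typedP[_ _ ->]] := eqv_typed (h2 w2).
apply: eqv_Comp; last exact: (proj2 gg).
by rewrite -e; apply: (proj2 ff).
Qed.

Lemma dtnsE f g : dtns (ev f) (ev g) = ev (f \ox g)%T.
Proof.
apply: lift2E => {}f f' {}g g' [ef ff] [eg gg]; split=> /= [|/andP[wf_f wg]].
  by rewrite ef eg.
by apply: eqv_Tens; [apply: ff|apply: gg].
Qed.

Lemma daddE f g : dadd (ev f) (ev g) = ev (Add f g).
Proof.
rewrite /dadd; have [f' -> [ef ff]] := repr_ev f; have [g' -> [eg gg]] := repr_ev g.
apply: ev_eq; split=> /= [|/and4P[wf_f wg /eqP es /eqP et]].
  rewrite -ef -eg; have [/= w1|//] := boolP (wf f'); have [/= w2|//] := boolP (wf g').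
  have [_ /typedP[_ -> ->]] := eqv_typed (ff w1).
  by have [_ /typedP[_ -> ->]] := eqv_typed (gg w2).
apply: eqv_Add; first exact: ff.
by rewrite es et; apply: gg.
Qed.

Lemma dsclE c f : dscl c (ev f) = ev (Scale c f).
Proof.
rewrite /dscl; have [f' -> [ef ff]] := repr_ev f.
by apply: ev_eq; split=> //= wf_f; apply: eqv_Scale; apply: ff.
Qed.

Lemma dadd0l : left_id ev0 dadd.
Proof. by move=> x; rewrite /dadd repr_ev0. Qed.

Lemma dadd0r : right_id ev0 dadd.
Proof.
elim/diag_ind => [|f]; rewrite /dadd repr_ev0 //.
by have [g ->] := repr_ev f.
Qed.

Lemma dscl0 c : dscl c ev0 = ev0.
Proof. by rewrite /dscl repr_ev0. Qed.

Definition dE := (dcmpE, dtnsE, daddE, dsclE,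
  (lift2_0l (@Comp k P) : left_zero ev0 dcmp),
  (lift2_0r (@Comp k P) : right_zero ev0 dcmp),
  (lift2_0l (@Tens k P) : left_zero ev0 dtns),
  (lift2_0r (@Tens k P) : right_zero ev0 dtns),
  dadd0l, dadd0r, dscl0).

Lemma eq_catl (u s t : word) : (u ++ s == u ++ t) = (s == t).
Proof. by rewrite eqseq_cat // eqxx. Qed.

Lemma eq_catr (u s t : word) : (s ++ u == t ++ u) = (s == t).
Proof.
rewrite -(inj_eq (can_inj revK)) !rev_cat eq_catl.
exact: inj_eq (can_inj revK) _ _.
Qed.

Ltac hyps := repeat lazymatch goal with
  | |- is_true (_ && _) -> _ => move/andP => []
  | |- is_true (_ == _) -> _ => move/eqP => ?
  | |- is_true (wf _) -> _ => move=> ?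
  | |- is_true true -> _ => move=> _
  end.
Ltac wf_eq := rewrite /= ?cats0; apply/idP/idP; hyps;
  repeat (apply/andP; split);
  lazymatch goal with
  | |- is_true (_ == _) => apply/eqP; congruence
  | |- _ => first [assumption | reflexivity]
  end.
Ltac solve_typed := apply/typedP; split; first [reflexivity | assumption | simpl;
  congruence].

Lemma daddA : associative dadd.
Proof.
elim/diag_ind=> [|f]; elim/diag_ind=> [|g]; elim/diag_ind=> [|h]; rewrite !dE //.
apply: ev_eq; split; first by wf_eq.
by move=> /=; hyps; eapply eqv_addA; solve_typed.
Qed.

Lemma daddC : commutative dadd.
Proof.
elim/diag_ind=> [|f]; elim/diag_ind=> [|g]; rewrite !dE //.
apply: ev_eq; split; first by wf_eq.
by move=> /=; hyps; eapply eqv_addC; solve_typed.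
Qed.

Lemma dadd_cancel u v x y z : dty u v x -> dty u v y -> dty u v (dadd x z) ->
  dadd x z = dadd y z -> x = y.
Proof.
case=> f tf -> [g tg ->]; elim/diag_ind: z => [|h];
  rewrite !dE // => -[t /typedP[wt st tt]].
move=> e1 e2; have [_ st' tt'] := teq_wf (teq_sym (ev_inj e1)) wt.
have [/and4P[_ wh /eqP esh /eqP eth] _ _] := teq_wf (teq_sym (ev_inj e1)) wt.
have [/typedP [wf_f sf tgf] /typedP [wg sg tgg]] := (tf, tg).
have th : typed u v h by apply/typedP; split; first [assumption | congruence].
have e : eqv u v (Add f h) (Add g h) by apply: ev_eqvP e2; apply: typed_Add.
apply: (@ev_eqv u v); apply: (cls_inj (tf := tf) (tg := tg)).
apply: (addIr (cls th)); rewrite !cls_add; exact: eq_cls.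
Qed.

Lemma dscl1 x : dscl 1 x = x.
Proof.
elim/diag_ind: x => [|f]; rewrite !dE //; apply: ev_eq; split=> //= w.
by apply: eqv_scale1; apply: typed_src_tgt.
Qed.

Lemma dsclA c d x : dscl c (dscl d x) = dscl (c * d) x.
Proof.
elim/diag_ind: x => [|f]; rewrite !dE //; apply: ev_eq; split=> //= w.
by apply: eqv_scaleA; apply: typed_src_tgt.
Qed.

Lemma dsclD c : {morph dscl c : x y / dadd x y}.
Proof.
elim/diag_ind=> [|f]; elim/diag_ind=> [|g]; rewrite !dE //.
apply: ev_eq; split=> //=; hyps.
by apply: eqv_scaleDr; solve_typed.
Qed.

Lemma dcmpA : associative dcmp.
Proof.
elim/diag_ind=> [|f]; elim/diag_ind=> [|g]; elim/diag_ind=> [|h]; rewrite !dE //.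
apply: ev_eq; split; first by wf_eq.
by move=> /=; hyps; eapply eqv_compA; solve_typed.
Qed.

Lemma dcmpDl : left_distributive dcmp dadd.
Proof.
elim/diag_ind=> [|f]; elim/diag_ind=> [|g]; elim/diag_ind=> [|h]; rewrite !dE //.
apply: ev_eq; split; first by wf_eq.
by move=> /=; hyps; eapply eqv_compDl; solve_typed.
Qed.

Lemma dcmpDr : right_distributive dcmp dadd.
Proof.
elim/diag_ind=> [|f]; elim/diag_ind=> [|g]; elim/diag_ind=> [|h]; rewrite !dE //.
apply: ev_eq; split; first by wf_eq.
by move=> /=; hyps; eapply eqv_compDr; solve_typed.
Qed.

Lemma dcmpZl c f g : dcmp (dscl c f) g = dscl c (dcmp f g).
Proof.
elim/diag_ind: f => [|f]; elim/diag_ind: g => [|g]; rewrite !dE //.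
apply: ev_eq; split; first by wf_eq.
by move=> /=; hyps; eapply eqv_compZl; solve_typed.
Qed.

Lemma dcmpZr c f g : dcmp f (dscl c g) = dscl c (dcmp f g).
Proof.
elim/diag_ind: f => [|f]; elim/diag_ind: g => [|g]; rewrite !dE //.
apply: ev_eq; split; first by wf_eq.
by move=> /=; hyps; eapply eqv_compZr; solve_typed.
Qed.

Lemma dtnsA : associative dtns.
Proof.
elim/diag_ind=> [|f]; elim/diag_ind=> [|g]; elim/diag_ind=> [|h]; rewrite !dE //.
apply: ev_eq; split; first by wf_eq.
by move=> /=; hyps; eapply eqv_tensA; solve_typed.
Qed.

Lemma dtnsDl : left_distributive dtns dadd.
Proof.
elim/diag_ind=> [|f]; elim/diag_ind=> [|g]; elim/diag_ind=> [|h]; rewrite !dE //.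
apply: ev_eq; split; first by rewrite /= !eq_catr; wf_eq.
by move=> /=; hyps; eapply eqv_tensDl; solve_typed.
Qed.

Lemma dtnsDr : right_distributive dtns dadd.
Proof.
elim/diag_ind=> [|f]; elim/diag_ind=> [|g]; elim/diag_ind=> [|h]; rewrite !dE //.
apply: ev_eq; split; first by rewrite /= !eq_catl; wf_eq.
by move=> /=; hyps; eapply eqv_tensDr; solve_typed.
Qed.

Lemma dtnsZl c f g : dtns (dscl c f) g = dscl c (dtns f g).
Proof.
elim/diag_ind: f => [|f]; elim/diag_ind: g => [|g]; rewrite !dE //.
apply: ev_eq; split; first by wf_eq.
by move=> /=; hyps; eapply eqv_tensZl; solve_typed.
Qed.

Lemma dtnsZr c f g : dtns f (dscl c g) = dscl c (dtns f g).
Proof.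
elim/diag_ind: f => [|f]; elim/diag_ind: g => [|g]; rewrite !dE //.
apply: ev_eq; split; first by wf_eq.
by move=> /=; hyps; eapply eqv_tensZr; solve_typed.
Qed.

Lemma didn_cmp u v f : dty u v f -> dcmp (didn v) f = f.
Proof. by case=> t tt ->; rewrite dE; apply: (@ev_eqv u v); apply: eqv_idl. Qed.

Lemma dcmp_idn u v f : dty u v f -> dcmp f (didn u) = f.
Proof. by case=> t tt ->; rewrite dE; apply: (@ev_eqv u v); apply: eqv_idr. Qed.

Lemma didn1_tns f : dtns (didn [::]) f = f.
Proof.
elim/diag_ind: f => [|f]; rewrite !dE //; apply: ev_eq; split=> //= w.
by apply: eqv_tens1l; apply: typed_src_tgt.
Qed.

Lemma dtns_idn1 f : dtns f (didn [::]) = f.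
Proof.
elim/diag_ind: f => [|f]; rewrite !dE //; apply: ev_eq; split; first by wf_eq.
by rewrite /= !cats0; hyps; apply: eqv_tens1r; apply: typed_src_tgt.
Qed.

Lemma didnM u v : didn (u ++ v) = dtns (didn u) (didn v).
Proof. by rewrite dE; apply/esym; apply: ev_eqv; apply: eqv_tens_id. Qed.

Lemma didn_tns_cmp u f g :
  dtns (didn u) (dcmp f g) = dcmp (dtns (didn u) f) (dtns (didn u) g).
Proof.
elim/diag_ind: f => [|f]; elim/diag_ind: g => [|g]; rewrite !dE //.
apply: ev_eq; split; first by rewrite /= !eq_catl; wf_eq.
move=> /=; hyps.
apply: (@eqv_trans _ _ _ _ _ (Tens (Comp (Id u) (Id u)) (Comp f g))).
  apply: eqv_Tens; first by apply: eqv_sym; apply: eqv_idl; apply: typed_Id.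
  by apply: eqv_refl; eapply typed_Comp; solve_typed.
by eapply eqv_interchange; solve_typed.
Qed.

Lemma dcmp_tns_idn u f g :
  dtns (dcmp f g) (didn u) = dcmp (dtns f (didn u)) (dtns g (didn u)).
Proof.
elim/diag_ind: f => [|f]; elim/diag_ind: g => [|g]; rewrite !dE //.
apply: ev_eq; split; first by rewrite /= !eq_catr; wf_eq.
move=> /=; hyps.
apply: (@eqv_trans _ _ _ _ _ (Tens (Comp f g) (Comp (Id u) (Id u)))).
  apply: eqv_Tens; last by apply: eqv_sym; apply: eqv_idl; apply: typed_Id.
  by apply: eqv_refl; eapply typed_Comp; solve_typed.
by eapply eqv_interchange; solve_typed.
Qed.

Lemma dinterchange u v w u' v' w' f g f' g' :
  dty v w f -> dty u v g -> dty v' w' f' -> dty u' v' g' ->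
  dtns (dcmp f g) (dcmp f' g') = dcmp (dtns f f') (dtns g g').
Proof.
move=> [t1 h1 ->] [t2 h2 ->] [t3 h3 ->] [t4 h4 ->]; rewrite !dE.
by apply: ev_eqv; apply: eqv_interchange; eassumption.
Qed.

Lemma dty_idn u : dty u u (didn u).
Proof. by exists (Id u) => //; apply: typed_Id. Qed.

Lemma dty_cmp u v w f g : dty v w f -> dty u v g -> dty u w (dcmp f g).
Proof.
move=> [t1 h1 ->] [t2 h2 ->]; rewrite !dE.
by exists (Comp t1 t2) => //; apply: typed_Comp h1 h2.
Qed.

Lemma dty_tns u v u' v' f g : dty u v f -> dty u' v' g ->
  dty (u ++ u') (v ++ v') (dtns f g).
Proof.
move=> [t1 h1 ->] [t2 h2 ->]; rewrite !dE.
by exists (Tens t1 t2) => //; apply: typed_Tens h1 h2.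
Qed.

Lemma dty_add u v f g : dty u v f -> dty u v g -> dty u v (dadd f g).
Proof.
move=> [t1 h1 ->] [t2 h2 ->]; rewrite !dE.
by exists (Add t1 t2) => //; apply: typed_Add h1 h2.
Qed.

Lemma dty_scl u v c f : dty u v f -> dty u v (dscl c f).
Proof. by move=> [t h ->]; rewrite dE; exists (Scale c t). Qed.

Canonical pres_diag : diagcat k :=
  @DiagCat k tdiag word [::] cat dty ev0 dadd dscl didn dcmp dtns
    (@catA _) (@cat0s _) (@cats0 _) daddA daddC dadd0l dadd_cancel
    dscl1 dsclA dscl0 dsclD
    dcmpA (lift2_0l _) (lift2_0r _) dcmpDl dcmpDr dcmpZl dcmpZr
    dtnsA (lift2_0l _) (lift2_0r _) dtnsDl dtnsDr dtnsZl dtnsZr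
    didn_cmp dcmp_idn didn1_tns dtns_idn1 didnM didn_tns_cmp dcmp_tns_idn
    dinterchange dty_idn dty_cmp dty_tns dty_add dty_scl.

End PresentedDiagrams.

Local Open Scope diag_scope.

(** * Webs and the naturality of crossings *)

(** The summand of the square relation, with the thicknesses of the two outer
strands [s], [t] and of the two crossing strands [a], [c] as free parameters:
the diagram goes from (s + a) \ox (c + t) to (s + c) \ox (a + t), and no
subtraction is needed to type it. *)
Definition square_diag (k : fieldType) (C : diagcat k) (st : nat -> wd C)
    (mg sp cr : nat -> nat -> C) (s a c t : nat) : C :=
  (mg s c \ox mg a t) \bo (idn (st s) \ox cr a c \ox idn (st t))
    \bo (sp s a \ox sp c t).

(** Merges, splits and crossings with those relations that are stable under
[mirror] and [flip]. Thickness 0 is included: the summands of the square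
relation then have the same form at the ends of the range of summation. *)
Record webs (k : fieldType) (q : k) (C : diagcat k) := Webs {
  st : nat -> wd C;
  mg : nat -> nat -> C;
  sp : nat -> nat -> C;
  cr : nat -> nat -> C;
  st0 : st 0 = wd1;
  ty_mg : forall a b, ty (mulw (st a) (st b)) (st (a + b)) (mg a b);
  ty_sp : forall a b, ty (st (a + b)) (mulw (st a) (st b)) (sp a b);
  ty_cr : forall a b, ty (mulw (st a) (st b)) (mulw (st b) (st a)) (cr a b);
  mg0n : forall b, mg 0 b = idn (st b);
  mgn0 : forall a, mg a 0 = idn (st a);
  sp0n : forall b, sp 0 b = idn (st b);
  spn0 : forall a, sp a 0 = idn (st a);
  cr0n : forall b, cr 0 b = idn (st b);
  crn0 : forall a, cr a 0 = idn (st a);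
  mgA : forall a b c, mg (a + b) c \bo (mg a b \ox idn (st c)) =
    mg a (b + c) \bo (idn (st a) \ox mg b c);
  spA : forall a b c, (sp a b \ox idn (st c)) \bo sp (a + b) c =
    (idn (st a) \ox sp b c) \bo sp a (b + c);
  squareE : forall a b c d, (a + c = b + d)%N -> sp b d \bo mg a c =
    \big[@add k C/nul]_(s < (minn a b).+1)
      \big[@add k C/nul]_(t < (minn c d).+1 | (t + a == s + d)%N)
        scl (q ^+ (s * t)) (square_diag st mg sp cr s (a - s) (c - t) t)
}.

(** The reflection exchanges the two indices of summation in the square
relation. *)
Definition mirror (k : fieldType) (q : k) (C : diagcat k) (W : webs q C) :
  webs q (mirror_cat C).
Proof.
refine (@Webs k q (mirror_cat C) (st W) (fun a b => mg W b a) (fun a b => sp W b a)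
  (fun a b => cr W b a) (st0 W) _ _ _ (@mgn0 _ _ _ W) (@mg0n _ _ _ W)
  (@spn0 _ _ _ W) (@sp0n _ _ _ W) (@crn0 _ _ _ W) (@cr0n _ _ _ W) _ _ _) => /=.
- by move=> a b; rewrite addnC; apply: ty_mg.
- by move=> a b; rewrite addnC; apply: ty_sp.
- by move=> a b; apply: ty_cr.
- by move=> a b c; rewrite addnC [(b + c)%N]addnC -mgA.
- by move=> a b c; rewrite [(a + b)%N]addnC [(b + c)%N]addnC -spA.
move=> a b c d e; rewrite (@squareE _ _ _ W c d a b); last by lia.
rewrite (exchange_big_dep xpredT) //=; apply: eq_bigr => s _.
apply: eq_big => [t|t _]; first by apply/eqP/eqP; lia.
by rewrite mulnC /square_diag /= tnsA.
Defined.

(** A square summand with middle strands [a], [c] becomes one with middle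
strands [c], [a]. *)
Definition flip (k : fieldType) (q : k) (C : diagcat k) (W : webs q C) :
  webs q (flip_cat C).
Proof.
refine (@Webs k q (flip_cat C) (st W) (sp W) (mg W) (fun a b => cr W b a)
  (st0 W) (@ty_sp _ _ _ W) (@ty_mg _ _ _ W) _ (@sp0n _ _ _ W) (@spn0 _ _ _ W)
  (@mg0n _ _ _ W) (@mgn0 _ _ _ W) (@crn0 _ _ _ W) (@cr0n _ _ _ W)
  (@spA _ _ _ W) (@mgA _ _ _ W) _) => /=.
- by move=> a b; apply: ty_cr.
move=> a b c d e; rewrite (@squareE _ _ _ W b a d c); last by lia.
rewrite minnC; apply: eq_bigr => s _; rewrite (minnC c d).
apply: eq_big => [t|t /eqP et]; first by apply/eqP/eqP; lia.
rewrite /square_diag /= cmpA.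
by have [-> ->] : (b - s = c - t /\ d - t = a - s)%N by lia.
Defined.

Section Typing.
Variables (k : fieldType) (q : k) (C : diagcat k) (W : webs q C).

Lemma ty_cast u v u' v' (f : C) : ty u' v' f -> u' = u -> v' = v -> ty u v f.
Proof. by move=> tf <- <-. Qed.

Lemma ty_cmp_cast u v v' w (f g : C) :
  ty v w f -> ty u v' g -> v' = v -> ty u w (f \bo g).
Proof. by move=> tf tg e; rewrite e in tg; apply: ty_cmp tf tg. Qed.

End Typing.

(* Words are compared strand by strand, and thicknesses by linear arithmetic. *)
Ltac word_eq := rewrite ?mulwA ?mul1w ?mulw1;
  repeat match goal with
    | |- mulw _ _ = mulw _ _ => f_equal
    | |- st _ _ = st _ _ => f_equal
    end; solve [reflexivity | lia].
Ltac synth_ty := lazymatch goal with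
  | |- ty _ _ (cmp _ _) => eapply ty_cmp_cast; [synth_ty | synth_ty | word_eq]
  | |- ty _ _ (tns _ _) => eapply ty_tns; synth_ty
  | |- ty _ _ (scl _ _) => eapply ty_scl; synth_ty
  | |- ty _ _ (idn _) => eapply ty_idn
  | |- ty _ _ (mg _ _ _) => eapply ty_mg
  | |- ty _ _ (sp _ _ _) => eapply ty_sp
  | |- ty _ _ (cr _ _ _) => eapply ty_cr
  | |- _ => solve [eauto]
  end.
Ltac ty_auto := solve [eapply ty_cast; [synth_ty | word_eq | word_eq]].

Section Exchange.
Variables (k : fieldType) (C : diagcat k).
Implicit Types (f g h : C).

Lemma tns_cmpl u v w u' v' f g h : ty v w f -> ty u v g -> ty u' v' h ->
  (f \bo g) \ox h = (f \ox idn v') \bo (g \ox h).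
Proof.
by move=> tf tg th; rewrite -{1}(idn_cmp th) (interchange tf tg (ty_idn _) th).
Qed.

Lemma tns_cmpr u v w u' v' f g h : ty v w f -> ty u v g -> ty u' v' h ->
  h \ox (f \bo g) = (idn v' \ox f) \bo (h \ox g).
Proof.
by move=> tf tg th; rewrite -{1}(idn_cmp th) (interchange (ty_idn _) th tf tg).
Qed.

Lemma cmpr_tns u v w u' v' f g h : ty v w f -> ty u v g -> ty u' v' h ->
  h \ox (f \bo g) = (h \ox f) \bo (idn u' \ox g).
Proof.
by move=> tf tg th; rewrite -{1}(cmp_idn th) (interchange th (ty_idn _) tf tg).
Qed.

Lemma slide u v u' v' f g : ty u v f -> ty u' v' g ->
  (f \ox idn v') \bo (idn u \ox g) = (idn v \ox g) \bo (f \ox idn u').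
Proof.
move=> tf tg; rewrite -(interchange tf (ty_idn _) (ty_idn _) tg).
rewrite -(interchange (ty_idn _) tf tg (ty_idn _)).
by rewrite (idn_cmp tf) (cmp_idn tf) (idn_cmp tg) (cmp_idn tg).
Qed.

Lemma cmp_rew f g h : f \bo g = h -> forall x, f \bo (g \bo x) = h \bo x.
Proof. by move=> <- x; rewrite cmpA. Qed.

End Exchange.

Section Naturality.
Variables (k : fieldType) (q : k) (C : diagcat k) (W : webs q C).
Local Notation "'1_ a" := (idn (st W a)) (at level 8, a at level 2, format "''1_' a").
Local Notation mg := (mg W).
Local Notation sp := (sp W).
Local Notation cr := (cr W).
Local Notation st := (st W).

(** One leg of the merge is thin: this is the case that an induction adding one
strand at a time requires. *)
Definition cr_natl a b : Prop := cr a.+1 b \bo (mg a 1 \ox '1_b) =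
  ('1_b \ox mg a 1) \bo (cr a b \ox '1_1) \bo ('1_a \ox cr 1 b).

(** The diagram in which a thin strand, entering between [s + a] and [b + t],
crosses [b] and joins [a] and [t]. It is a summand common to the two expansions
compared in [cr_natl_step]; [outer_diag] below, its mirror image, where the thin
strand joins [s] and [b], is the other kind of summand. *)
Definition inner_diag s a b t : C :=
  (mg s b \ox (mg a t.+1 \bo ('1_a \ox mg 1 t))) \bo
  ('1_s \ox cr a b \ox '1_1 \ox '1_t) \bo
  ('1_s \ox '1_a \ox cr 1 b \ox '1_t) \bo
  (sp s a \ox '1_1 \ox sp b t).

Definition square_top s a c t : C :=
  (mg s c \ox mg a t) \bo ('1_s \ox cr a c \ox '1_t).

(** Naturality lifts the merge above the crossing, and associativity then moves
the thin strand from [a] to [t]. *)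
Lemma top_merge s a b t : cr_natl a b ->
  square_top s a.+1 b t \bo
    ((('1_s \ox mg a 1) \bo (sp s a \ox '1_1)) \ox sp b t) =
  inner_diag s a b t.
Proof.
move=> IH; rewrite /square_top /inner_diag.
rewrite (tns_cmpl (u := mulw (st (s + a)) (st 1))
  (v := mulw (st s) (mulw (st a) (st 1)))
  (w := mulw (st s) (st (a + 1))) (u' := st (b + t)) (v' := mulw (st b) (st t)));
    try ty_auto.
have nat : ('1_s \ox cr a.+1 b \ox '1_t) \bo ('1_s \ox mg a 1 \ox '1_b \ox '1_t) =
    ('1_s \ox '1_b \ox mg a 1 \ox '1_t) \bo ('1_s \ox cr a b \ox '1_1 \ox '1_t)
      \bo ('1_s \ox '1_a \ox cr 1 b \ox '1_t).
  rewrite -cmp_tns_idn -(tnsA _ _ '1_b) -idn_tns_cmp IH.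
  by rewrite !idn_tns_cmp !cmp_tns_idn !tnsA.
have top : (mg s b \ox mg a.+1 t) \bo ('1_s \ox '1_b \ox mg a 1 \ox '1_t) =
    mg s b \ox (mg a t.+1 \bo ('1_a \ox mg 1 t)).
  rewrite -idnM -tnsA -(cmpr_tns (v := mulw (st a.+1) (st t)) (w := st (a.+1 + t))
    (u := mulw (mulw (st a) (st 1)) (st t)) (v' := st (s + b))); try ty_auto.
  by rewrite -addn1 mgA add1n.
by rewrite -!cmpA idnM !tnsA (cmp_rew nat) -!cmpA (cmp_rew top).
Qed.

(** Here the thin strand has already crossed [b], and its merge with [t] is
disjoint from the crossing of [a] and [b]: the interchange law suffices. *)
Lemma top_cross s a b t :
  square_top s a b t.+1 \bo
    (sp s a \ox (('1_b \ox mg 1 t) \bo (cr 1 b \ox '1_t) \bo ('1_1 \ox sp b t))) =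
  inner_diag s a b t.
Proof.
rewrite /square_top /inner_diag.
rewrite (tns_cmpr (u := mulw (st 1) (st (b + t)))
  (v := mulw (st b) (mulw (st 1) (st t)))
  (w := mulw (st b) (st (1 + t))) (u' := st (s + a)) (v' := mulw (st s) (st a)));
    try ty_auto.
rewrite (tns_cmpr (u := mulw (st 1) (st (b + t)))
  (v := mulw (st 1) (mulw (st b) (st t)))
  (w := mulw (st b) (mulw (st 1) (st t))) (u' := st (s + a)) (v' := mulw (st s)
    (st a))); try ty_auto.
have nat : ('1_s \ox cr a b \ox '1_t.+1) \bo ('1_s \ox '1_a \ox '1_b \ox mg 1 t) =
    ('1_s \ox '1_b \ox '1_a \ox mg 1 t) \bo ('1_s \ox cr a b \ox '1_1 \ox '1_t).
  have := slide (u := mulw (mulw (st s) (st a)) (st b))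
    (v := mulw (mulw (st s) (st b)) (st a))
    (u' := mulw (st 1) (st t)) (v' := st (1 + t)) (f := '1_s \ox cr a b) (g := mg 1 t).
  by rewrite !idnM !tnsA => -> //; ty_auto.
have top : (mg s b \ox mg a t.+1) \bo ('1_s \ox '1_b \ox '1_a \ox mg 1 t) =
    mg s b \ox (mg a t.+1 \bo ('1_a \ox mg 1 t)).
  by rewrite -idnM -tnsA -(cmpr_tns (v := mulw (st a) (st t.+1)) (w := st (a + t.+1))
    (u := mulw (st a) (mulw (st 1) (st t))) (v' := st (s + b))); try ty_auto.
by rewrite -!cmpA idnM !tnsA (cmp_rew nat) -!cmpA (cmp_rew top).
Qed.

Definition cr_natr a b : Prop := cr a b.+1 \bo ('1_a \ox mg 1 b) =
  (mg 1 b \ox '1_a) \bo ('1_1 \ox cr a b) \bo (cr a 1 \ox '1_b).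

Definition outer_diag s a b t : C :=
  ((mg s.+1 b \bo (mg s 1 \ox '1_b)) \ox mg a t) \bo
  ('1_s \ox '1_1 \ox cr a b \ox '1_t) \bo
  ('1_s \ox cr a 1 \ox '1_b \ox '1_t) \bo
  (sp s a \ox '1_1 \ox sp b t).

(** The condition on the indices determines [t] from [s]. *)
Lemma squareE_left a b c d : (a + c = b + d)%N -> sp b d \bo mg a c =
  \big[@add k C/nul]_(s < (minn a b).+1 | (a <= s + d)%N)
    (q ^+ (s * (s + d - a)) \: square_diag st mg sp cr s (a - s) (b - s) (s + d - a)).
Proof.
move=> e; rewrite squareE // [RHS]big_mkcond; apply: eq_bigr => -[s hs] _ /=.
case: leqP => h; last first.
  by rewrite big1 // => t /eqP et; lia.
have ht : (s + d - a < (minn c d).+1)%N by move: hs; rewrite ltnS !leq_min; lia.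
rewrite (big_pred1 (Ordinal ht)) => [/=|t].
  by have -> : (c - (s + d - a) = b - s)%N by move: hs; lia.
by rewrite /= -val_eqE /=; apply/eqP/eqP; lia.
Qed.

(** The square relation when the right leg of the merge is thin: that strand
goes entirely to one of the two sides of the split. *)
Lemma split_merge1 a s n : (s + n = a.+1)%N -> sp s n \bo mg a 1 =
  (if s is s'.+1 then (mg s' 1 \ox '1_n) \bo ('1_s' \ox cr n 1) \bo (sp s' n \ox '1_1)
   else nul) \+
  (if n is n'.+1 then q ^+ s \: ('1_s \ox mg n' 1) \bo (sp s n' \ox '1_1) else nul).
Proof.
case: s n => [|s] [|n] // e.
- rewrite add0n in e; case: e => <-; rewrite add0 expr0 scl1 sp0n sp0n st0 idn1_tns.
   by rewrite -idnM (idn_cmp (u := mulw (st n) (st 1)) (v := st n.+1)) ?(cmp_idn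
     (u := mulw (st n) (st 1)) (v := st n.+1)); try ty_auto.
- move: e; rewrite addn0 => -[<-]; rewrite addC add0 !spn0 st0 tns_idn1 cr0n -!idnM.
  rewrite (idn_cmp (u := mulw (st s) (st 1)) (v := st s.+1)); last by ty_auto.
  by rewrite (cmp_idn (u := mulw (st s) (st 1)) (v := mulw (st s) (st 1))) ?(cmp_idn
    (u := mulw (st s) (st 1)) (v := st s.+1)); try ty_auto.
rewrite squareE_left; last by lia.
have -> : minn a s.+1 = s.+1 by apply/minn_idPr; lia.
rewrite big_mkcond !big_ord_recr big1 /= => [|i _]; last by case: i => i hi /=;
  rewrite ifF //; lia.
rewrite add0 !ifT; try lia.
have -> : (s + n.+1 - a = 0)%N by lia.
have -> : (s.+1 + n.+1 - a = 1)%N by lia.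
have -> : (a - s = n.+1)%N by lia.
have -> : (a - s.+1 = n)%N by lia.
have -> : (s.+1 - s = 1)%N by lia.
rewrite subnn muln0 muln1 scl1 /square_diag !mgn0 !spn0 !sp0n !crn0 st0 !tns_idn1.
congr (_ \+ (_ \: _)).
by rewrite -!idnM (idn_cmp (u := mulw (st (s.+1 + n)) (st 1)) (v := mulw (mulw
  (st s.+1) (st n)) (st 1))); try ty_auto.
Qed.

End Naturality.

Section NaturalityStep.
Variables (k : fieldType) (q : k) (C : diagcat k) (W : webs q C).
Local Notation "'1_ a" := (idn (st W a)) (at level 8, a at level 2, format "''1_' a").
Local Notation mg := (mg W).
Local Notation sp := (sp W).
Local Notation cr := (cr W).
Local Notation st := (st W).

(** A square summand below which a thin strand is merged into the left leg: the
merge meets the split of that leg, and [split_merge1] gives two diagrams. *)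
Lemma square_mgl a s n b t : (s.+1 + n = a.+1)%N ->
  (forall n', n = n'.+1 -> cr_natl W n' b) ->
  square_diag st mg sp cr s.+1 n b t \bo (mg a 1 \ox '1_(b + t)) =
  outer_diag W s n b t \+
    (if n is n'.+1 then q ^+ s.+1 \: inner_diag W s.+1 n' b t else nul).
Proof.
move=> e IH.
rewrite /square_diag -!cmpA -(interchange (v := st a.+1) (u := mulw (st a) (st 1))
  (w := mulw (st s.+1) (st n)) (u' := st (b + t)) (v' := st (b + t))
  (w' := mulw (st b) (st t))); try ty_auto.
rewrite (split_merge1 W e) (cmp_idn (u := st (b + t)) (v := mulw (st b) (st t)));
  last by ty_auto.
rewrite cmpA -/(square_top W s.+1 n b t) tnsDl cmpDr; congr (_ \+ _).
  have := top_cross (mirror W) t b n s.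
  by rewrite /square_top /outer_diag /inner_diag /= !tnsA -!cmpA.
case: n e IH => [|n] e IH; first by rewrite tns_null cmp_nulr.
by rewrite tnsZl cmpZr top_merge //; apply: IH.
Qed.

(** The same with the thin strand merged into the right leg. The summands are
again of the two kinds met in [square_mgl]. *)
Lemma square_mgr a b s n t : (n + t = b)%N ->
  (forall n', n = n'.+1 -> cr_natr W a n') ->
  square_diag st mg sp cr s a n t.+1 \bo ('1_(s + a) \ox mg 1 b) =
  inner_diag W s a n t \+
    (if n is n'.+1 then q ^+ t.+1 \: outer_diag W s a n' t.+1 else nul).
Proof.
move=> e IH.
rewrite /square_diag -!cmpA -(interchange (v := st (s + a)) (u := st (s + a))
  (w := mulw (st s) (st a)) (u' := mulw (st 1) (st b)) (v' := st b.+1)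
  (w' := mulw (st n) (st t.+1))); try ty_auto.
have e' : (t.+1 + n = b.+1)%N by lia.
rewrite (split_merge1 (mirror W) e') (cmp_idn (u := st (s + a)) (v := mulw (st s)
  (st a))); last by ty_auto.
rewrite cmpA -/(square_top W s a n t.+1) tnsDr cmpDr; congr (_ \+ _).
  exact: top_cross.
case: n e e' IH => [|n] e e' IH; first by rewrite tns_nulr cmp_nulr.
rewrite tnsZr cmpZr; congr (_ \: _).
have IHr : cr_natl (mirror W) n a.
  by have := IH n erefl; rewrite /cr_natr /cr_natl /= !cmpA.
have := @top_merge _ _ _ (mirror W) t.+1 n a s IHr.
by rewrite /square_top /outer_diag /inner_diag /= !tnsA -!cmpA.
Qed.

Lemma cmp_suml (I : Type) (r : seq I) (P : pred I) (F : I -> C) g :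
  (\big[@add k C/nul]_(i <- r | P i) F i) \bo g =
  \big[@add k C/nul]_(i <- r | P i) (F i \bo g).
Proof.
exact: (big_morph (fun f => f \bo g) (fun x y => cmpDl x y g) (cmp_null g)).
Qed.

Lemma big_ord_same n m (P Q : pred nat) (F : nat -> C) :
  (forall i, (i < n) && P i = (i < m) && Q i)%N ->
  \big[@add k C/nul]_(i < n | P i) F i = \big[@add k C/nul]_(i < m | Q i) F i.
Proof.
move=> e; rewrite (big_ord_widen_cond (n + m) P F) ?leq_addr //.
rewrite (big_ord_widen_cond (n + m) Q F) ?leq_addl //.
by apply: eq_bigl => i; rewrite andbC e andbC.
Qed.

(** Both sides of the associativity of the merge of [a], [1], [b], followed by
a split into [b] and [a.+1], are sums over [s] of the diagrams [I s] and [O s],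
up to the term [s = 0] of each: on one side it is the left side of [cr_natl],
on the other it is [I 0], which is the right side of [cr_natl]. The summands
whose comparison requires naturality contain crossings of smaller total
thickness. *)
Lemma cr_natl_step a b :
  (forall i j, (i + j < a + b)%N -> cr_natl W i j) ->
  (forall i j, (i + j < a + b)%N -> cr_natr W i j) -> cr_natl W a b.
Proof.
move=> IHl IHr.
pose I s := q ^+ (s * s.+1) \: inner_diag W s (a - s) (b - s) s.
pose O s := q ^+ (s.+1 * s.+1) \: outer_diag W s (a - s) (b - s.+1) s.+1.
(* The outer strands of [I 0] have thickness 0. *)
have inner0 : I 0%N = ('1_b \ox mg a 1) \bo (cr a b \ox '1_1) \bo ('1_a \ox cr 1 b).
  rewrite /I /inner_diag mul0n expr0 scl1 !subn0 mg0n sp0n spn0 mgn0 st0 !idn1_tns !tns_idn1.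
  rewrite -!idnM (cmp_idn (u := mulw (st a) (st 1)) (v := st a.+1)); last by ty_auto.
  by rewrite (cmp_idn (u := mulw (mulw (st a) (st 1)) (st b)) (v := mulw (mulw (st a)
    (st b)) (st 1))) //; ty_auto.
(* The summand [s = 0] is the left side of [cr_natl]: its outer strands have
   thickness 0. *)
have eqF : (sp b a.+1 \bo mg a.+1 b) \bo (mg a 1 \ox '1_b) =
    (cr a.+1 b \bo (mg a 1 \ox '1_b)) \+
      (\big[@add k C/nul]_(s < minn a b) I s.+1 \+
       \big[@add k C/nul]_(s < minn a.+1 b) O s).
  rewrite (squareE_left W (addnC a.+1 b)) cmp_suml big_mkcond big_ord_recl /=.
  congr (_ \+ _).
    rewrite leq_addl mul0n expr0 scl1 addnK !subn0 /square_diag mg0n mgn0 sp0n spn0 st0.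
    rewrite idn1_tns tns_idn1 -!idnM.
    rewrite (idn_cmp (u := mulw (st a.+1) (st b)) (v := mulw (st b) (st a.+1))); last
      by ty_auto.
    by rewrite (cmp_idn (u := mulw (st a.+1) (st b)) (v := mulw (st b) (st a.+1)))
      //; ty_auto.
  rewrite (@big_ord_same (minn a b) (minn a.+1 b) xpredT (fun s => (s < a)%N)
    (fun s => I s.+1)); last first.
    by move=> i /=; rewrite !ltn_min; apply/idP/idP; lia.
  rewrite [X in X \+ _]big_mkcond -big_split; apply: eq_bigr => -[s hs] _ /=.
  have {hs} [sa sb] : (s <= a /\ s < b)%N by lia.
  rewrite /bump add1n ifT; last by lia.
  rewrite addnK cmpZl.
  have -> : '1_b = '1_(b - s.+1 + s.+1) by rewrite subnK.
  rewrite square_mgl //; first 1 last.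
  - by lia.
  - by move=> n' en; apply: IHl; lia.
  rewrite sclD addC subSS; congr (_ \+ _).
  case: ltnP => h; last by (have -> : (a - s = 0)%N by lia); rewrite scl_nul.
  have -> : (a - s = (a - s.+1).+1)%N by lia.
  by rewrite sclA -exprD /I -mulnSr.
have eqG : (sp b a.+1 \bo mg a b.+1) \bo ('1_a \ox mg 1 b) =
    I 0%N \+
      (\big[@add k C/nul]_(s < minn a b) I s.+1 \+
       \big[@add k C/nul]_(s < minn a.+1 b) O s).
  have e : (a + b.+1 = b + a.+1)%N by lia.
  rewrite (squareE_left W e) cmp_suml big_mkcond.
  rewrite (@big_ord_same (minn a.+1 b) (minn a b).+1 xpredT (fun s => (s < b)%N) O);
    last first.
    by move=> i /=; rewrite ltn_min !ltnS leq_min; apply/idP/idP; lia.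
  rewrite [X in _ = I 0%N \+ (_ \+ X)]big_mkcond addA -(big_ord_recl (minn a b) I).
  rewrite -big_split; apply: eq_bigr => -[s hs] _ /=.
  have {hs} [sa sb] : (s <= a /\ s <= b)%N by lia.
  rewrite ifT; last by lia.
  have -> : (s + a.+1 - a = s.+1)%N by lia.
  rewrite cmpZl -[X in '1_X](subnKC sa).
  rewrite square_mgr; first 1 last.
  - by lia.
  - by move=> n' en; apply: IHr; lia.
  rewrite sclD; congr (_ \+ _).
  case: ltnP => h; last by (have -> : (b - s = 0)%N by lia); rewrite scl_nul.
  have -> : (b - s = (b - s.+1).+1)%N by lia.
  by rewrite sclA -exprD /O -mulSnr.
have tF : ty (mulw (mulw (st a) (st 1)) (st b)) (mulw (st b) (st a.+1))
    ((sp b a.+1 \bo mg a.+1 b) \bo (mg a 1 \ox '1_b)) by ty_auto.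
rewrite eqF in tF.
rewrite /cr_natl -inner0.
refine (add_cancel (u := mulw (mulw (st a) (st 1)) (st b))
  (v := mulw (st b) (st a.+1)) _ _ tF _).
- by ty_auto.
- by rewrite inner0; ty_auto.
by rewrite -eqF -eqG -!cmpA -addn1 mgA add1n addn1.
Qed.

End NaturalityStep.

(** [cr_natr W a b] is [cr_natl (mirror W) b a], so the step applied to [W] and
to its mirror image carries a simultaneous induction. *)
Lemma cr_nat (k : fieldType) (q : k) (C : diagcat k) (W : webs q C) a b :
  cr_natl W a b /\ cr_natr W a b.
Proof.
have [n] := ubnP (a + b); elim: n a b => // n IHn a b; rewrite ltnS => hab.
split; first by apply: cr_natl_step => i j hij; have [] := IHn i j (leq_trans hij hab).
suff : cr_natl (mirror W) b a by rewrite /cr_natl /cr_natr /= !cmpA.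
apply: cr_natl_step => i j hij.
  have [_] : cr_natl W j i /\ cr_natr W j i by apply: IHn; lia.
  by rewrite /cr_natl /cr_natr /= !cmpA.
have [+ _] : cr_natl W j i /\ cr_natr W j i by apply: IHn; lia.
by rewrite /cr_natl /cr_natr /= !cmpA.
Qed.

(** * Thick dots and their passage through merges and splits *)

Section Thin.
Variables (k : fieldType) (q : k) (C : diagcat k).

Definition thin_word (W : webs q C) n := iter n (mulw (st W 1)) wd1.

Fixpoint merge_all (W : webs q C) n : C :=
  if n is n'.+1 then mg W 1 n' \bo (idn (st W 1) \ox merge_all W n')
  else idn (st W 0).

Fixpoint split_all (W : webs q C) n : C :=
  if n is n'.+1 then (idn (st W 1) \ox split_all W n') \bo sp W 1 n'
  else idn (st W 0).

Definition tensor_pow (W : webs q C) (f : C) n := iter n (tns f) (idn (st W 0)).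

Lemma ty_merge_all W n : ty (thin_word W n) (st W n) (merge_all W n).
Proof.
elim: n => [|n IHn] /=; first by rewrite -(st0 W); apply: ty_idn.
exact: ty_cmp (ty_mg W 1 n) (ty_tns (ty_idn _) IHn).
Qed.

Lemma ty_split_all W n : ty (st W n) (thin_word W n) (split_all W n).
Proof.
elim: n => [|n IHn] /=; first by rewrite -(st0 W); apply: ty_idn.
exact: ty_cmp (ty_tns (ty_idn _) IHn) (ty_sp W 1 n).
Qed.

Lemma ty_tensor_pow W f n : ty (st W 1) (st W 1) f ->
  ty (thin_word W n) (thin_word W n) (tensor_pow W f n).
Proof.
move=> tf; elim: n => [|n IHn] /=; first by rewrite (st0 W); apply: ty_idn.
exact: ty_tns.
Qed.

Lemma tensor_pow_add W f a b :
  tensor_pow W f (a + b) = tensor_pow W f a \ox tensor_pow W f b.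
Proof.
by elim: a => [|a IHa] /=; rewrite ?st0 ?idn1_tns ?IHa ?tnsA.
Qed.

Lemma merge_all_add W a b :
  merge_all W (a + b) = mg W a b \bo (merge_all W a \ox merge_all W b).
Proof.
elim: a => [|a IHa].
  by rewrite /= mg0n st0 idn1_tns (idn_cmp (ty_merge_all W b)).
have tb := ty_merge_all W b; have ta := ty_merge_all W a.
rewrite addSn /= (tns_cmpl (ty_mg W 1 a) (ty_tns (ty_idn _) ta) tb).
by rewrite IHa idn_tns_cmp cmpA -mgA add1n -!cmpA tnsA.
Qed.

End Thin.

Section Thick.
Variables (k : fieldType) (q : k) (C : diagcat k) (W : webs q C).
Local Notation "'1_ a" := (idn (st W a)) (at level 8, a at level 2, format "''1_' a").
Local Notation mg := (mg W).
Local Notation sp := (sp W).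
Local Notation cr := (cr W).
Local Notation st := (st W).

(** A recursive form of (1/[n]!) m_{1^n} f^{\otimes n} s_{1^n}; see
[merge_pow_split]. It splits off one strand at a time, as the inductions
below do. *)
Fixpoint thick (f : C) n : C :=
  if n is n'.+1 then (qint q n)^-1 \: mg 1 n' \bo (f \ox thick f n') \bo sp 1 n'
  else '1_0.

Hypothesis qint_neq0 : forall n, (0 < n)%N -> qint q n != 0.
Hypothesis digon1 : forall n, mg 1 n \bo sp 1 n = qint q n.+1 \: '1_n.+1.

Lemma qfact_neq0 n : qfact q n != 0.
Proof.
rewrite /qfact prodf_seq_neq0; apply/allP => i.
by rewrite mem_index_iota => /andP[i0 _]; rewrite qint_neq0.
Qed.

Lemma qfactS n : qfact q n.+1 = qint q n.+1 * qfact q n.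
Proof. by rewrite /qfact big_nat_recr //= mulrC. Qed.

Lemma merge_split_all n : merge_all W n \bo split_all W n = qfact q n \: '1_n.
Proof.
elim: n => [|n IHn]; first by rewrite /= (idn_cmp (ty_idn _)) /qfact big_nil scl1.
rewrite /= -cmpA (cmpA ('1_1 \ox _)) -idn_tns_cmp IHn tnsZr -idnM cmpZl cmpZr.
by rewrite (idn_cmp (ty_sp W 1 n)) digon1 sclA mulrC qfactS.
Qed.

Lemma scl_inj c : c != 0 -> injective (@scl k C c).
Proof.
by move=> c0 x y /(congr1 (scl c^-1)); rewrite !sclA mulVf // !scl1.
Qed.

(** Merging [n] thin strands is a split epimorphism since [n]! is invertible;
identities between thick webs may thus be checked on thin strands. *)
Lemma merge_all_epi n v f g : ty (st n) v f -> ty (st n) v g ->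
  f \bo merge_all W n = g \bo merge_all W n -> f = g.
Proof.
move=> tf tg /(congr1 (fun h => h \bo split_all W n));
  rewrite /= -!cmpA merge_split_all.
by rewrite !cmpZr (cmp_idn tf) (cmp_idn tg) => /scl_inj -> //; apply: qfact_neq0.
Qed.

Lemma merge_all2_epi a b v f g :
  ty (mulw (st a) (st b)) v f -> ty (mulw (st a) (st b)) v g ->
  f \bo (merge_all W a \ox merge_all W b) =
  g \bo (merge_all W a \ox merge_all W b) -> f = g.
Proof.
move=> tf tg /(congr1 (fun h => h \bo (split_all W a \ox split_all W b)));
  rewrite /= -!cmpA.
rewrite -(interchange (ty_merge_all W a) (ty_split_all W a) (ty_merge_all W b)
  (ty_split_all W b)).
rewrite !merge_split_all tnsZl tnsZr !cmpZr -idnM (cmp_idn tf) (cmp_idn tg) !sclA.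
by move=> /scl_inj -> //; rewrite mulf_neq0 ?qfact_neq0.
Qed.

(** The mirror image of [split_merge1], for the split with a thin left leg. *)
Lemma split_merge1n n : sp 1 n.+1 \bo mg 1 n.+1 =
  (('1_1 \ox mg 1 n) \bo (cr 1 1 \ox '1_n) \bo ('1_1 \ox sp 1 n)) \+
  (q ^+ n.+1 \: '1_1 \ox '1_n.+1).
Proof.
have e : (n.+1 + 1 = n.+2)%N by lia.
rewrite (split_merge1 (mirror W) e) /= !mgn0 !sp0n; congr (_ \+ (_ \: _)).
by rewrite -idnM (idn_cmp (ty_idn _)).
Qed.

Section Dot.
Variable f : C.
Hypothesis tf : ty (st 1) (st 1) f.
Hypothesis crf : cr 1 1 \bo (f \ox f) = (f \ox f) \bo cr 1 1.

Lemma ty_thick n : ty (st n) (st n) (thick f n).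
Proof.
elim: n => [|n IHn] /=; first exact: ty_idn.
by apply: ty_scl; apply: ty_cmp (ty_mg W 1 n) (ty_cmp (ty_tns tf IHn) (ty_sp W 1 n)).
Qed.

(** Since [mg 1 n \bo sp 1 n] is the scalar [qint q n.+1], a diagram that
commutes with [sp 1 n \bo mg 1 n] induces one on the strand of thickness
[n.+1]. *)
Lemma thick_step n :
  (f \ox thick f n) \bo (sp 1 n \bo mg 1 n) =
    (sp 1 n \bo mg 1 n) \bo (f \ox thick f n) ->
  thick f n.+1 \bo mg 1 n = mg 1 n \bo (f \ox thick f n) /\
  sp 1 n \bo thick f n.+1 = (f \ox thick f n) \bo sp 1 n.
Proof.
move=> comm; have tt := ty_tns tf (ty_thick n).
rewrite /=; split.
  rewrite cmpZl -!cmpA comm -cmpA (cmpA (mg 1 n)) digon1 cmpZl sclA mulVf ?qint_neq0 //.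
  by rewrite scl1 (idn_cmp (ty_cmp (ty_mg W 1 n) tt)).
rewrite cmpZr !cmpA -comm -!cmpA digon1 !cmpZr sclA.
by rewrite mulVf ?qint_neq0 // scl1 (cmp_idn (ty_sp W 1 n)).
Qed.

(** By [split_merge1n] it is enough to commute with the web through the crossing
of two thin strands. The induction hypothesis moves the dots past the merge and
the split of that web, and [crf] moves them past the crossing. *)
Lemma thick_comm n : (f \ox thick f n) \bo (sp 1 n \bo mg 1 n) =
    (sp 1 n \bo mg 1 n) \bo (f \ox thick f n).
Proof.
have tt := ty_thick.
elim: n => [|n IHn].
  rewrite /= mgn0 spn0 (idn_cmp (ty_idn _)) st0 tns_idn1.
  by rewrite (idn_cmp tf) (cmp_idn tf).
have [Hm Hs] := thick_step IHn.
rewrite split_merge1n cmpDl cmpDr; congr (_ \+ _); last first.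
  by rewrite cmpZl cmpZr -idnM (idn_cmp (ty_tns tf (tt n.+1))) (cmp_idn (ty_tns tf
    (tt n.+1))).
have tm := ty_mg W 1 n; have ts := ty_sp W 1 n.
rewrite -!cmpA -(interchange (ty_idn _) tf ts (tt n.+1)) Hs (idn_cmp tf).
rewrite (cmpr_tns (ty_tns tf (tt n)) ts tf) cmpA -(cmpr_tns (tt n.+1) tm tf) Hm.
rewrite (tns_cmpr tm (ty_tns tf (tt n)) tf) -!cmpA.
congr (_ \bo _); rewrite !cmpA tnsA; congr (_ \bo _).
rewrite -(interchange (ty_cr W 1 1) (ty_tns tf tf) (ty_idn _) (tt n)).
rewrite -(interchange (ty_tns tf tf) (ty_cr W 1 1) (tt n) (ty_idn _)).
by rewrite crf (idn_cmp (tt n)) (cmp_idn (tt n)).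
Qed.

Lemma thick_merge1 n : thick f n.+1 \bo mg 1 n = mg 1 n \bo (f \ox thick f n).
Proof. by have [] := thick_step (thick_comm n). Qed.

Lemma merge_all_thick n :
  merge_all W n \bo tensor_pow W f n = thick f n \bo merge_all W n.
Proof.
elim: n => [|n IHn]; first by rewrite /= (idn_cmp (ty_idn _)).
have tp := ty_tensor_pow n tf; have tm := ty_merge_all W n; have tt := ty_thick n.
rewrite /= -cmpA -[f \ox iter _ _ _]/(f \ox tensor_pow W f n).
rewrite -(tns_cmpr tm tp tf) IHn (cmpr_tns tt tm tf) cmpA.
by rewrite -thick_merge1 cmpA.
Qed.

Lemma merge_pow_split n : merge_all W n \bo (tensor_pow W f n \bo split_all W n) =
  qfact q n \: thick f n.
Proof.
by rewrite cmpA merge_all_thick -cmpA merge_split_all cmpZr (cmp_idn (ty_thick n)).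
Qed.

(** After merging thin strands both sides are m_{1^{a+b}} with a dot on each
strand. *)
Lemma thick_merge a b :
  thick f (a + b) \bo mg a b = mg a b \bo (thick f a \ox thick f b).
Proof.
have tt := ty_thick; have tm := ty_mg W a b.
apply: merge_all2_epi (ty_cmp (tt _) tm) (ty_cmp tm (ty_tns (tt a) (tt b))) _.
have ta := ty_merge_all W a; have tb := ty_merge_all W b.
have tpa := ty_tensor_pow a tf; have tpb := ty_tensor_pow b tf.
rewrite -!cmpA -merge_all_add -merge_all_thick merge_all_add tensor_pow_add -cmpA.
rewrite -(interchange ta tpa tb tpb) !merge_all_thick.
by rewrite (interchange (tt a) ta (tt b) tb).
Qed.

End Dot.

Lemma thick_idn n : thick '1_1 n = '1_n.
Proof.
elim: n => //= n ->; rewrite -idnM (idn_cmp (ty_sp W 1 n)) digon1 sclA.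
by rewrite mulVf ?qint_neq0 // scl1.
Qed.

(** Seen on thin strands, both sides put [f \bo g] on each strand. *)
Lemma thick_cmp f g n : ty (st 1) (st 1) f -> ty (st 1) (st 1) g ->
  cr 1 1 \bo (f \ox f) = (f \ox f) \bo cr 1 1 ->
  cr 1 1 \bo (g \ox g) = (g \ox g) \bo cr 1 1 ->
  thick f n \bo thick g n = thick (f \bo g) n.
Proof.
move=> tf tg cf cg; have tfg := ty_cmp tf tg.
have cfg : cr 1 1 \bo ((f \bo g) \ox (f \bo g)) = ((f \bo g) \ox (f \bo g)) \bo cr 1 1.
  by rewrite (interchange tf tg tf tg) cmpA cf -cmpA cg cmpA.
apply: (merge_all_epi (ty_cmp (ty_thick tf n) (ty_thick tg n)) (ty_thick tfg n)).
rewrite -cmpA -!merge_all_thick // cmpA -merge_all_thick // -cmpA; congr (_ \bo _).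
elim: n => [|n IHn] /=; first by rewrite (idn_cmp (ty_idn _)).
by rewrite -(interchange tf tg (ty_tensor_pow n tf) (ty_tensor_pow n tg)) -IHn.
Qed.

Lemma thick_one f : ty (st 1) (st 1) f -> thick f 1 = f.
Proof.
move=> tf; have := digon1 0; rewrite /= mgn0 spn0 (idn_cmp (ty_idn _)) => d1.
rewrite st0 tns_idn1 (cmp_idn tf) (idn_cmp tf) -[X in _ \: X](idn_cmp tf) -cmpZl.
have -> : (qint q 1)^-1 \: '1_1 = '1_1 by rewrite {1}d1 sclA mulVf ?scl1 ?qint_neq0.
exact: idn_cmp tf.
Qed.

End Thick.

(** The construction of [thick] is symmetric under turning upside down, which
turns [thick_merge] into the statement on splits. *)
Lemma thick_op (k : fieldType) (q : k) (C : diagcat k) (W : webs q C) (f : C) n :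
  thick (flip W) f n = thick W f n :> C.
Proof. by elim: n => //= n ->; rewrite cmpA. Qed.

Lemma split_thick (k : fieldType) (q : k) (C : diagcat k) (W : webs q C) :
  (forall n, (0 < n)%N -> qint q n != 0) ->
  (forall n, mg W 1 n \bo sp W 1 n = qint q n.+1 \: idn (st W n.+1)) ->
  forall f, ty (st W 1) (st W 1) f ->
  cr W 1 1 \bo (f \ox f) = (f \ox f) \bo cr W 1 1 ->
  forall a b, sp W a b \bo thick W f (a + b) =
    (thick W f a \ox thick W f b) \bo sp W a b.
Proof.
move=> q0 d f tf cf a b; rewrite -(thick_op W f (a + b)) -(thick_op W f a)
  -(thick_op W f b).
exact: (@thick_merge _ _ _ (flip W) q0 d f tf (esym cf) a b).
Qed.

(** * Passage of thick dots through crossings *)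

Section Slide.
Variables (k : fieldType) (q : k) (C : diagcat k) (W : webs q C).
Local Notation "'1_ a" := (idn (st W a)) (at level 8, a at level 2, format "''1_' a").
Local Notation mg := (mg W).
Local Notation sp := (sp W).
Local Notation cr := (cr W).
Local Notation st := (st W).
Hypothesis qint_neq0 : forall n, (0 < n)%N -> qint q n != 0.
Hypothesis digon1 : forall n, mg 1 n \bo sp 1 n = qint q n.+1 \: '1_n.+1.
Hypothesis digonr : forall n, exists2 c, c != 0 & mg n 1 \bo sp n 1 = c \: '1_n.+1.
Variable f : C.
Hypothesis tf : ty (st 1) (st 1) f.
Hypothesis slide11 : cr 1 1 \bo (f \ox '1_1) \bo cr 1 1 = '1_1 \ox f.

(** The dot on one strand passes to the other through two crossings; hence two
dots pass together through one. *)
Lemma cr_dots : cr 1 1 \bo (f \ox f) = (f \ox f) \bo cr 1 1.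
Proof.
have ti := ty_idn (st 1); have tc := ty_cr W 1 1.
have -> : f \ox f = (f \ox '1_1) \bo ('1_1 \ox f).
  by rewrite -(interchange tf ti ti tf) (cmp_idn tf) (idn_cmp tf).
have e : cr 1 1 \bo (f \ox '1_1) \bo ('1_1 \ox f) =
    ('1_1 \ox f) \bo (f \ox '1_1) \bo cr 1 1 by rewrite -slide11 -!cmpA.
by rewrite e cmpA -(slide tf tf).
Qed.

(** Write the identity of [b.+1] as a multiple of merge after split. By naturality
the two crossings of [b.+1] become crossings of the thin strand and of [b]
around the dot, to which the hypothesis and the induction apply. *)
Lemma thin_dot_slide b : cr 1 b \bo (f \ox '1_b) \bo cr b 1 = '1_b \ox f.
Proof.
elim: b => [|b IHb].
  by rewrite cr0n crn0 st0 tns_idn1 idn1_tns (cmp_idn tf) (idn_cmp tf).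
have ti n := ty_idn (st n).
(* Naturality for merges, and its upside-down form for splits. *)
have [_ /= natR] := cr_nat W 1 b; have [_ /=] := cr_nat (flip W) 1 b.
rewrite /cr_natr /= in natR * => natS.
apply: (scl_inj (qint_neq0 (ltn0Sn b))).
have -> : qint q b.+1 \: cr 1 b.+1 \bo (f \ox '1_b.+1) \bo cr b.+1 1 =
    (cr 1 b.+1 \bo ('1_1 \ox mg 1 b)) \bo (f \ox '1_1 \ox '1_b) \bo
    (('1_1 \ox sp 1 b) \bo cr b.+1 1).
  rewrite -cmpZr -cmpZl -tnsZr -digon1 -!cmpA; congr (_ \bo _).
  rewrite !cmpA; congr (_ \bo _); rewrite -(tnsA f) -idnM.
  have tm := ty_mg W 1 b; have ts := ty_sp W 1 b.
  rewrite -(interchange (ti 1) tf tm (ty_idn _)) (cmp_idn tm) (idn_cmp tf).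
  by rewrite -(interchange tf (ti 1) tm ts) (cmp_idn tf).
rewrite natR natS -!cmpA.
(* The dot lies between the two crossings that naturality has produced. *)
have mid : ('1_1 \ox cr 1 b) \bo (cr 1 1 \ox '1_b) \bo (f \ox '1_1 \ox '1_b) \bo
    (cr 1 1 \ox '1_b) \bo ('1_1 \ox cr b 1) = '1_1 \ox '1_b \ox f.
  rewrite (cmpA (f \ox _ \ox _)) -cmp_tns_idn (cmpA (cr 1 1 \ox _)) -cmp_tns_idn.
  by rewrite slide11 -tnsA -!idn_tns_cmp IHb tnsA.
have := congr1 (fun h => (mg 1 b \ox '1_1) \bo h \bo (sp 1 b \ox '1_1)) mid.
rewrite /= -!cmpA => ->.
have tm := ty_mg W 1 b; have ts := ty_sp W 1 b.
rewrite -idnM -(interchange (ty_idn _) ts tf (ti 1)) (idn_cmp ts) (cmp_idn tf).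
by rewrite -(interchange tm ts (ti 1) tf) (idn_cmp tf) digon1 tnsZl.
Qed.

(** The same reduction as in [thin_dot_slide], now on the strand that carries
the dot: [thick_merge] distributes it over the legs [a] and [1]. *)
Lemma dot_slide a b :
  cr a b \bo (thick W f a \ox '1_b) \bo cr b a = '1_b \ox thick W f a.
Proof.
have ti n := ty_idn (st n).
elim: a => [|a IHa].
  by rewrite /= cr0n crn0 st0 tns_idn1 idn1_tns !(idn_cmp (ti b)).
have [/= natL _] := cr_nat W a b; have [/= + _] := cr_nat (flip W) a b.
rewrite /cr_natl /= in natL * => natS.
have tm := ty_mg W a 1; have ts := ty_sp W a 1; rewrite addn1 in tm ts.
have tx := ty_thick tf a; have txS := ty_thick tf a.+1.
have [c c0 dc] := digonr a.
have dot_merge : thick W f a.+1 \bo mg a 1 = mg a 1 \bo (thick W f a \ox f).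
  by rewrite -addn1 (thick_merge qint_neq0 digon1 tf cr_dots)
    (thick_one qint_neq0 digon1 tf).
apply: (scl_inj c0).
have -> : c \: cr a.+1 b \bo (thick W f a.+1 \ox '1_b) \bo cr b a.+1 =
    (cr a.+1 b \bo (mg a 1 \ox '1_b)) \bo (thick W f a \ox f \ox '1_b) \bo
    ((sp a 1 \ox '1_b) \bo cr b a.+1).
  rewrite -cmpZr -cmpZl -tnsZl -!cmpA; congr (_ \bo _).
  rewrite !cmpA; congr (_ \bo _).
  rewrite -!cmp_tns_idn -dot_merge -cmpA dc cmpZr.
  by rewrite (cmp_idn txS).
rewrite natL natS -!cmpA.
have inner : ('1_a \ox cr 1 b) \bo (thick W f a \ox f \ox '1_b) \bo ('1_a \ox cr b 1) =
    thick W f a \ox '1_b \ox f.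
  have tfb := ty_tns tf (ti b); have tc := ty_cr W 1 b; have tc' := ty_cr W b 1.
  rewrite -!(tnsA (thick W f a)).
  rewrite -(interchange tx (ti a) tfb tc') (cmp_idn tx) -(interchange (ti a) tx tc
    (ty_cmp tfb tc')).
  by rewrite (idn_cmp tx) thin_dot_slide.
have outer : (cr a b \ox '1_1) \bo (thick W f a \ox '1_b \ox f) \bo (cr b a \ox '1_1) =
    '1_b \ox thick W f a \ox f.
  have txb := ty_tns tx (ti b); have tc := ty_cr W a b; have tc' := ty_cr W b a.
  rewrite -(interchange txb tc' tf (ti 1)) (cmp_idn tf).
  by rewrite -(interchange tc (ty_cmp txb tc') (ti 1) tf) (idn_cmp tf) IHa.
have := congr1 (fun h => ('1_b \ox mg a 1) \bo (cr a b \ox '1_1) \bo h \bo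
  (cr b a \ox '1_1) \bo ('1_b \ox sp a 1)) inner.
rewrite /= -!cmpA => ->.
have := congr1 (fun h => ('1_b \ox mg a 1) \bo h \bo ('1_b \ox sp a 1)) outer.
rewrite /= -!cmpA => ->.
rewrite -(tnsA '1_b) -!idn_tns_cmp cmpA -dot_merge -cmpA dc cmpZr.
by rewrite (cmp_idn txS) tnsZr.
Qed.

End Slide.

Local Close Scope diag_scope.

(** * The category with a thin dot as a system of webs *)

Section Evaluation.
Variables (k : fieldType) (P : presentation k).
Local Notation C := (pres_diag P).

Lemma ev_cmp (f g : term k P) : ev (f \o g)%T = cmp (ev f) (ev g).
Proof. by rewrite -dcmpE. Qed.
Lemma ev_tns (f g : term k P) : ev (f \ox g)%T = tns (ev f) (ev g).
Proof. by rewrite -dtnsE. Qed.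
Lemma ev_add (f g : term k P) : ev (Add f g) = add (ev f) (ev g).
Proof. by rewrite -daddE. Qed.
Lemma ev_scl c (f : term k P) : ev (Scale c f) = scl c (ev f).
Proof. by rewrite -dsclE. Qed.
Definition evE := (ev_cmp, ev_tns, ev_add, ev_scl).
Lemma dty_ev u v (f : term k P) : typed u v f -> @ty k C u v (ev f).
Proof. by exists f. Qed.
End Evaluation.

Lemma rel_ev (k : fieldType) (P : presentation k) (f g : term k P) :
  pres_rel f g -> ev f = ev g.
Proof.
move=> fg; have [u [v [tf tg]]] := pres_rel_typed fg.
by apply: (@ev_eqv _ _ u v); apply: eqv_rel.
Qed.

(** The typed zero that starts a sum of terms survives as one summand. *)
Lemma ev_big (k : fieldType) (P : presentation k) (u v : seq (gen_ob P))
    (I : Type) (r : seq I) (Q : pred I) (F : I -> term k P) :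
  ev (\big[@Add k P/Zero u v]_(i <- r | Q i) F i) =
  add (ev (Zero u v)) (\big[@add k (pres_diag P)/nul]_(i <- r | Q i) ev (F i)).
Proof.
elim: r => [|i r IHr]; first by rewrite !big_nil addC add0.
rewrite !big_cons; case: (Q i) => //.
by rewrite -daddE IHr !addA [X in add X _]addC.
Qed.

Lemma posnat_cases (n : nat) : n = 0%N \/ exists n' : posnat, n = n'.
Proof. by case: n => [|n]; [left | right; exists (PosNat (ltn0Sn n))]. Qed.

Section WebTermsZero.
Variables (k : fieldType) (D : Type) (th : D -> posnat).

Lemma insub0 : insub 0%N = None :> option posnat.
Proof. by rewrite insubF. Qed.

Lemma wmerge0n b : wmerge k th 0 b = idt k th b.
Proof. by rewrite /wmerge insub0. Qed.

Lemma wmergen0 a : wmerge k th a 0 = idt k th a.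
Proof. by rewrite /wmerge insub0 addn0; case: insub. Qed.

Lemma wsplit0n b : wsplit k th 0 b = idt k th b.
Proof. by rewrite /wsplit insub0. Qed.

Lemma wsplitn0 a : wsplit k th a 0 = idt k th a.
Proof. by rewrite /wsplit insub0 addn0; case: insub. Qed.

Lemma wcross0n b : wcross k th 0 b = idt k th b.
Proof. by rewrite /wcross insub0. Qed.

Lemma wcrossn0 a : wcross k th a 0 = idt k th a.
Proof. by rewrite /wcross insub0 addn0; case: insub. Qed.

End WebTermsZero.

(** When one of the four thicknesses vanishes, the double sum of the square
relation has a single term. *)
Lemma big_square_collapse (R : Type) (idx : R) (op : Monoid.com_law idx)
    (a b c d s0 t0 : nat) (F : nat -> nat -> R) :
  (s0 <= minn a b)%N -> (t0 <= minn c d)%N -> (t0 + a = s0 + d)%N ->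
  (forall s t, s <= minn a b -> t <= minn c d -> t + a = s + d -> s = s0)%N ->
  \big[op/idx]_(s < (minn a b).+1)
    \big[op/idx]_(t < (minn c d).+1 | (t + a == s + d)%N) F s t = F s0 t0.
Proof.
move=> hs ht e uniq; rewrite (bigD1 (Ordinal (hs : s0 < (minn a b).+1)%N)) //=.
rewrite [X in op _ X]big1 => [|[s lts] /= ns]; last first.
  rewrite big1 // => -[t ltt] /= /eqP e'; case/eqP: ns; apply: val_inj => /=.
  exact: (uniq s t).
rewrite Monoid.mulm1 (big_pred1 (Ordinal (ht : t0 < (minn c d).+1)%N)) // => -[t ltt].
by rewrite /= -val_eqE /=; apply/eqP/eqP; lia.
Qed.

Section WebPrime.
Variables (k : fieldType) (q : k).
Let P := web'_pres q.
Local Notation C := (pres_diag P).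
Local Notation wmerge := (wmerge k thick1).
Local Notation wsplit := (wsplit k thick1).
Local Notation wcross := (wcross k thick1).
Local Notation idt := (idt k thick1).
Local Notation ev := (@ev k P).
Local Notation ids n := (@idn k C (strand n)).

Lemma common_ev f g : common_rel q f g -> ev f = ev g.
Proof. by move=> fg; apply: rel_ev; apply: web'_common. Qed.

Lemma ev_idt n : ev (idt n) = ids n. Proof. by []. Qed.
Lemma ty_merge a b :
  @ty k C (strand a ++ strand b) (strand (a + b)) (ev (wmerge a b)).
Proof. exact: (@dty_ev k P _ _ _ (typed_merge k thick1 a b)). Qed.
Lemma ty_split a b :
  @ty k C (strand (a + b)) (strand a ++ strand b) (ev (wsplit a b)).
Proof. exact: (@dty_ev k P _ _ _ (typed_split k thick1 a b)). Qed.
Lemma ty_cross a b :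
  @ty k C (strand a ++ strand b) (strand b ++ strand a) (ev (wcross a b)).
Proof. exact: (@dty_ev k P _ _ _ (typed_cross k thick1 a b)). Qed.

Lemma idn0 : ids 0 = @idn k C wd1.
Proof. by rewrite strand0. Qed.

Lemma ev_merge_assoc a b c :
  cmp (ev (wmerge (a + b) c)) (tns (ev (wmerge a b)) (ids c)) =
  cmp (ev (wmerge a (b + c))) (tns (ids a) (ev (wmerge b c))).
Proof.
have [-> | [a' ->]] := posnat_cases a.
  rewrite !wmerge0n add0n !ev_idt strand0 idn1_tns -idnM.
  by rewrite (idn_cmp (ty_merge b c)) (cmp_idn (ty_merge b c)).
have [-> | [b' ->]] := posnat_cases b.
  by rewrite addn0 add0n wmerge0n wmergen0 !ev_idt.
have [-> | [c' ->]] := posnat_cases c.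
  rewrite !wmergen0 addn0 !ev_idt strand0 tns_idn1 -idnM.
  by rewrite (idn_cmp (ty_merge _ _)) (cmp_idn (ty_merge _ _)).
by rewrite -!ev_idt -!ev_tns -!ev_cmp; apply: common_ev; apply: merge_assoc.
Qed.

Lemma ev_split_assoc a b c :
  cmp (tns (ev (wsplit a b)) (ids c)) (ev (wsplit (a + b) c)) =
  cmp (tns (ids a) (ev (wsplit b c))) (ev (wsplit a (b + c))).
Proof.
have [-> | [a' ->]] := posnat_cases a.
  rewrite !wsplit0n add0n !ev_idt strand0 idn1_tns -idnM.
  by rewrite (idn_cmp (ty_split b c)) (cmp_idn (ty_split b c)).
have [-> | [b' ->]] := posnat_cases b.
  by rewrite addn0 add0n wsplit0n wsplitn0 !ev_idt.
have [-> | [c' ->]] := posnat_cases c.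
  rewrite !wsplitn0 addn0 !ev_idt strand0 tns_idn1 -idnM.
  by rewrite (idn_cmp (ty_split _ _)) (cmp_idn (ty_split _ _)).
by rewrite -!ev_idt -!ev_tns -!ev_cmp; apply: common_ev; apply: split_assoc.
Qed.

Let X := @square_diag k C strand (fun a b => ev (wmerge a b))
  (fun a b => ev (wsplit a b)) (fun a b => ev (wcross a b)).

Lemma ev_square_summand a b c d s t : (b - s = c - t)%N ->
  ev (square_summand thick1 q a b c d s t) = scl (q ^+ (s * t)) (X s (a - s) (c - t) t).
Proof. by move=> e; rewrite /square_summand !evE e. Qed.

(** The typed zeros of the inner and outer sums are absorbed by any typed
summand, and the sum has one: the indices [minn a b] and [minn c d] satisfy the
condition of summation. *)
Lemma ev_square_sum a b c d : (a + c = b + d)%N ->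
  ev (square_sum thick1 q a b c d) =
  \big[@add k C/nul]_(s < (minn a b).+1)
    \big[@add k C/nul]_(t < (minn c d).+1 | (t + a == s + d)%N)
      scl (q ^+ (s * t)) (X s (a - s) (c - t) t).
Proof.
move=> e; rewrite /square_sum ev_big.
under eq_bigr => s _ do rewrite ev_big.
rewrite big_split addA.
set u := strand a ++ strand c; set v := strand b ++ strand d.
set Z := ev (@Zero k P u v).
have ZZ : add Z Z = Z.
  by rewrite -ev_add; apply: (@ev_eqv k P u v); apply: eqv_add0; apply: typed_Zero.
have -> : add Z (\big[@add k C/nul]_(s < (minn a b).+1) Z) = Z.
  elim/big_ind: _ => [|x y hx hy|//]; first by rewrite addC add0.
  by rewrite addA hx hy.
have Zx x : @ty k C u v x -> dadd Z x = x.
  by case=> f tf ->; rewrite daddE; apply: (@ev_eqv k P u v); apply: eqv_add0.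
pose S := \big[@add k C/nul]_(s < (minn a b).+1)
  \big[@add k C/nul]_(t < (minn c d).+1 | (t + a == s + d)%N)
    ev (square_summand thick1 q a b c d s t).
transitivity S.
  rewrite -/S /S (bigD1 (ord_max : 'I_(minn a b).+1)) //.
  rewrite (bigD1 (ord_max : 'I_(minn c d).+1)) /=; last by apply/eqP; lia.
  rewrite !daddA Zx //; apply: (@dty_ev k P u v).
  by apply: typed_square_summand => //; lia.
apply: eq_bigr => -[s hs] _; apply: eq_bigr => -[t ht] /= /eqP et.
by rewrite ev_square_summand //; lia.
Qed.

Lemma square_diag_0n b d : X 0 0 b d = ev (wsplit b d).
Proof.
rewrite /X /square_diag !wmerge0n !wcross0n !wsplit0n !ev_idt !idn0 !idn1_tns -!idnM.
by rewrite !(idn_cmp (ty_split b d)).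
Qed.

Lemma square_diag_n0 b d : X b d 0 0 = ev (wsplit b d).
Proof.
rewrite /X /square_diag !wmergen0 !wcrossn0 !wsplit0n !ev_idt !idn0 !tns_idn1 -!idnM.
by rewrite !(idn_cmp (ty_split b d)).
Qed.

Lemma square_diag_merge a c : X 0 a 0 c = ev (wmerge a c).
Proof.
rewrite /X /square_diag !wmerge0n !wcrossn0 !wsplit0n !ev_idt !idn0 !idn1_tns -!idnM.
by rewrite (cmp_idn (ty_idn _)) (cmp_idn (ty_merge a c)).
Qed.

Lemma square_diag_merge' a c : X a 0 c 0 = ev (wmerge a c).
Proof.
rewrite /X /square_diag !wmergen0 !wcross0n !wsplitn0 !ev_idt !idn0 !tns_idn1 -!idnM.
by rewrite (cmp_idn (ty_idn _)) (cmp_idn (ty_merge a c)).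
Qed.

(** The defining relation has positive thicknesses; for the other cases the
relation reduces to a unit law. *)
Lemma ev_square a b c d : (a + c = b + d)%N ->
  cmp (ev (wsplit b d)) (ev (wmerge a c)) =
  \big[@add k C/nul]_(s < (minn a b).+1)
    \big[@add k C/nul]_(t < (minn c d).+1 | (t + a == s + d)%N)
      scl (q ^+ (s * t)) (X s (a - s) (c - t) t).
Proof.
move=> e; pose F s t := scl (q ^+ (s * t)) (X s (a - s) (c - t) t).
have ts := ty_split b d; have tm := ty_merge a c.
have collapse := @big_square_collapse _ _ (@add k C) a b c d _ _ F.
rewrite -/(F _ _).
have [a0 | [a' ea]] := posnat_cases a.
  rewrite (collapse 0%N d) /F; try by lia.
  rewrite mul0n scl1 a0 wmerge0n sub0n (_ : c - d = b)%N ?square_diag_0n; last by lia.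
  by rewrite ev_idt (_ : c = b + d)%N ?(cmp_idn ts); last by lia.
have [c0 | [c' ec]] := posnat_cases c.
  rewrite (collapse b 0%N) /F; try by lia.
  rewrite muln0 scl1 c0 wmergen0 subn0 (_ : a - b = d)%N ?square_diag_n0; last by lia.
  by rewrite ev_idt (_ : a = b + d)%N ?(cmp_idn ts); last by lia.
have [b0 | [b' eb]] := posnat_cases b.
  rewrite (collapse 0%N c) /F; try by lia.
  rewrite mul0n scl1 b0 wsplit0n subn0 subnn square_diag_merge.
  by rewrite ev_idt (_ : d = a + c)%N ?(idn_cmp tm); last by lia.
have [d0 | [d' ed]] := posnat_cases d.
  rewrite (collapse a 0%N) /F; try by lia.
  rewrite muln0 scl1 d0 wsplitn0 subn0 subnn square_diag_merge'.
  by rewrite ev_idt (_ : b = a + c)%N ?(idn_cmp tm); last by lia.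
rewrite -ev_square_sum // -ev_cmp; subst; apply: common_ev.
exact: square.
Qed.

Definition web'_webs : webs q C := @Webs k q C strand
  (fun a b => ev (wmerge a b)) (fun a b => ev (wsplit a b)) (fun a b => ev (wcross a b))
  strand0 ty_merge ty_split ty_cross
  (fun b => congr1 ev (wmerge0n _ _ b)) (fun a => congr1 ev (wmergen0 _ _ a))
  (fun b => congr1 ev (wsplit0n _ _ b)) (fun a => congr1 ev (wsplitn0 _ _ a))
  (fun b => congr1 ev (wcross0n _ _ b)) (fun a => congr1 ev (wcrossn0 _ _ a))
  ev_merge_assoc ev_split_assoc ev_square.

Hypothesis qint_neq0 : forall n, (0 < n)%N -> qint q n != 0.

Lemma qint1 : qint q 1 = 1.
Proof.
have := qint_neq0 (ltn0Sn 0); rewrite /qint !expr1 => h; rewrite divff //.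
by apply: contraNneq h => ->; rewrite mul0r.
Qed.

Lemma qbin_n1 n : qbin q n 1 = qint q n.
Proof. by rewrite /qbin /qfact big_ord1 big_nat1 qint1 divr1 subn0. Qed.

Lemma qbin_neq0 n a : (a <= n)%N -> qbin q n a != 0.
Proof.
move=> le_an; rewrite mulf_neq0 ?invr_neq0 ?(qfact_neq0 qint_neq0) //.
rewrite prodf_seq_neq0; apply/allP => -[i hi] _ /=; apply: qint_neq0; lia.
Qed.

Lemma ev_digon (a b : posnat) : cmp (ev (wmerge a b)) (ev (wsplit a b)) =
  scl (qbin q (a + b) a) (ids (a + b)).
Proof. by rewrite -ev_cmp (common_ev (@digon k unit thick1 q a b)) ev_scl. Qed.

Lemma web'_digon1 n : cmp (ev (wmerge 1 n)) (ev (wsplit 1 n)) =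
  scl (qint q n.+1) (ids n.+1).
Proof.
have [-> | [n' ->]] := posnat_cases n.
  by rewrite wmergen0 wsplitn0 (idn_cmp (ty_idn _)) qint1 scl1.
by rewrite (ev_digon pone) qbin_n1.
Qed.

Lemma web'_digonr n : exists2 c, c != 0 &
  cmp (ev (wmerge n 1)) (ev (wsplit n 1)) = scl c (ids n.+1).
Proof.
have [-> | [n' ->]] := posnat_cases n.
  by exists 1; rewrite ?oner_neq0 // wmerge0n wsplit0n (idn_cmp (ty_idn _)) scl1.
exists (qbin q (n' + 1) n'); first by apply: qbin_neq0; lia.
by rewrite (ev_digon n' pone) addn1.
Qed.
End WebPrime.

(** * Functors defined on generators *)

Section TermMap.
Variables (k : fieldType) (ob : eqType) (mor1 mor2 : Type).
Variables (s1 t1 : mor1 -> seq ob) (s2 t2 : mor2 -> seq ob).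
Let S1 := Signature s1 t1.
Let S2 := Signature s2 t2.
Variable im : mor1 -> term k S2.

Fixpoint tmap (t : term k S1) : term k S2 :=
  match t with
  | Id u => @Id k S2 u
  | Gen g => im g
  | Comp f g => Comp (tmap f) (tmap g)
  | Tens f g => Tens (tmap f) (tmap g)
  | Zero u v => @Zero k S2 u v
  | Add f g => Add (tmap f) (tmap g)
  | Scale c f => Scale c (tmap f)
  end.

Hypothesis typed_im : forall g, @typed k S2 (s1 g) (t1 g) (im g).

Lemma typed_tmap (t : term k S1) u v :
  @typed k S1 u v t -> @typed k S2 u v (tmap t).
Proof.
elim: t u v => [w|g|f IHf g IHg|f IHf g IHg|w w'|f IHf g IHg|c f IHf] u v
  /typedP[/= w_t <- <-].
- exact: typed_Id.
- exact: typed_im.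
- case/and3P: w_t => wf_f wg /eqP e; apply: (@typed_Comp k S2 _ (src f : seq ob)).
    by apply: IHf; apply/typedP.
  by apply: IHg; apply/typedP.
- case/andP: w_t => wf_f wg.
  by apply: (@typed_Tens k S2 (src f : seq ob) (tgt f : seq ob));
    [apply: IHf|apply: IHg]; apply/typedP.
- exact: typed_Zero.
- case/and4P: w_t => wf_f wg /eqP es /eqP et.
  by apply: typed_Add; [apply: IHf|apply: IHg]; apply/typedP.
- by apply: typed_Scale; apply: IHf; apply/typedP.
Qed.

Variables (R1 : term k S1 -> term k S1 -> Prop) (R2 : term k S2 -> term k S2 -> Prop).
Hypothesis H1 : forall f g, R1 f g -> exists u v, typed u v f /\ typed u v g.
Hypothesis H2 : forall f g, R2 f g -> exists u v, typed u v f /\ typed u v g.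
Let P1 := Presentation H1.
Let P2 := Presentation H2.
Hypothesis tmap_rel : forall f g, R1 f g -> @ev k P2 (tmap f) = @ev k P2 (tmap g).

(** Substitution commutes with every operation, so each axiom of linear monoidal
categories goes to an instance of itself, and only the imposed relations have
content. *)
Lemma eqv_tmap u v (f g : term k P1) : eqv u v f g -> @eqv k P2 u v (tmap f) (tmap g).
Proof.
have ty := typed_tmap.
elim=> {u v f g} /=.
all: try by [constructor; auto].
- by move=> u v f g h _ + _; apply: eqv_trans.
- by move=> u v w f f' g g' _ + _; apply: eqv_Comp.
- by move=> u v w x f g h tf tg th; apply: (@eqv_compA k P2 _ v w); apply: ty.
- by move=> u v w f f' g tf tg th; apply: (@eqv_compDl k P2 _ v); apply: ty.
- by move=> u v w f f' g tf tg th; apply: (@eqv_compDr k P2 _ v); apply: ty.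
- by move=> u v w c f g tf tg; apply: (@eqv_compZl k P2 _ v); apply: ty.
- by move=> u v w c f g tf tg; apply: (@eqv_compZr k P2 _ v); apply: ty.
- by move=> u v w u' v' w' f g f' g' tf tg th tk; apply:
  (@eqv_interchange k P2 _ v _ _ v'); apply: ty.
- by move=> u v f g fg tf tg; apply: ev_eqvP; [apply: ty|apply: tmap_rel].
Qed.

Let fhom (u v : seq ob) (x : @pres_hom k P1 u v) : @pres_hom k P2 u v :=
  cls (P := P2) (typed_tmap (rep_typed x)).

Lemma fhomE u v f (tf : @typed k S1 u v f) :
  fhom (cls (P := P1) tf) = cls (P := P2) (typed_tmap tf).
Proof. by apply: eq_cls; apply: eqv_tmap; apply: rep_cls. Qed.

Definition tmap_functor : slmfunctor (pres_cat P1) (pres_cat P2).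
Proof.
refine (@SLMFunctor k (pres_cat P1) (pres_cat P2) id fhom _ _ _ erefl
  (fun _ _ => erefl) _).
- move=> u v c; elim/cls_ind=> f tf; elim/cls_ind=> g tg.
  rewrite cls_scale cls_add !fhomE cls_scale cls_add; apply: eq_cls.
  by apply: eqv_refl; apply: typed_Add => //; apply: typed_tmap.
- move=> u; rewrite /= fhomE; apply: eq_cls.
  by apply: eqv_refl; apply: typed_Id.
- move=> u v w; elim/cls_ind=> f tf; elim/cls_ind=> g tg.
  rewrite /= hom_compE !fhomE hom_compE; apply: eq_cls.
  by apply: eqv_refl; apply: typed_Comp; apply: typed_tmap; eassumption.
- move=> u v u' v'; elim/cls_ind=> f tf; elim/cls_ind=> g tg.
  rewrite /= hom_tensE !fhomE hom_tensE; congr (pack _); apply: eq_cls.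
  by apply: eqv_refl; apply: typed_Tens; apply: typed_tmap.
Defined.

Lemma tmap_functor_mor u v f (tf : @typed k S1 u v f) :
  fun_hom tmap_functor (mor (P := P1) tf) = mor (P := P2) (typed_tmap tf).
Proof. exact: fhomE. Qed.

End TermMap.

Section InverseTermMaps.
Variables (k : fieldType) (ob : eqType) (mor1 mor2 : Type).
Variables (s1 t1 : mor1 -> seq ob) (s2 t2 : mor2 -> seq ob).
Let S1 := Signature s1 t1.
Let S2 := Signature s2 t2.
Variables (R1 : term k S1 -> term k S1 -> Prop) (R2 : term k S2 -> term k S2 -> Prop).
Hypothesis H1 : forall f g, R1 f g -> exists u v, typed u v f /\ typed u v g.
Hypothesis H2 : forall f g, R2 f g -> exists u v, typed u v f /\ typed u v g.
Let P1 := Presentation H1.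
Let P2 := Presentation H2.
Variables (im12 : mor1 -> term k S2) (im21 : mor2 -> term k S1).
Hypothesis typed12 : forall g, @typed k S2 (s1 g) (t1 g) (im12 g).
Hypothesis typed21 : forall g, @typed k S1 (s2 g) (t2 g) (im21 g).
Hypothesis rel12 : forall f g, R1 f g -> @ev k P2 (tmap im12 f) = @ev k P2
  (tmap im12 g).
Hypothesis rel21 : forall f g, R2 f g -> @ev k P1 (tmap im21 f) = @ev k P1
  (tmap im21 g).
Hypothesis imK : forall g, @ev k P1 (tmap im21 (im12 g)) = @ev k P1 (@Gen k S1 g).

Lemma tmapK (t : term k S1) : @ev k P1 (tmap im21 (tmap im12 t)) = @ev k P1 t.
Proof. by elim: t => //= [f IHf g IHg|f IHf g IHg|f IHf g IHg|c f IHf];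
  rewrite !evE ?IHf ?IHg. Qed.

Lemma tmap_functorK u v (f : @Defs.hom k (pres_cat P1) u v) :
  fun_hom (tmap_functor typed21 H2 rel21) (fun_hom (tmap_functor typed12 H1 rel12) f)
    = f.
Proof.
elim/cls_ind: f => f tf; rewrite !tmap_functor_mor; apply: eq_cls.
apply: (@ev_eqvP k P1 u v).
  by apply: (typed_tmap typed21); apply: (typed_tmap typed12); apply: rep_typed.
by rewrite tmapK; apply: (@ev_eqv k P1 u v); apply: rep_cls.
Qed.
End InverseTermMaps.

Lemma tmap_isomorphism (k : fieldType) (ob : eqType) (mor1 mor2 : Type)
    (s1 t1 : mor1 -> seq ob) (s2 t2 : mor2 -> seq ob)
    (S1 := Signature s1 t1) (S2 := Signature s2 t2)
    (R1 : term k S1 -> term k S1 -> Prop) (R2 : term k S2 -> term k S2 -> Prop)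
    (H1 : forall f g, R1 f g -> exists u v, typed u v f /\ typed u v g)
    (H2 : forall f g, R2 f g -> exists u v, typed u v f /\ typed u v g)
    (P1 := Presentation H1) (P2 := Presentation H2)
    (im12 : mor1 -> term k S2) (im21 : mor2 -> term k S1)
    (typed12 : forall g, @typed k S2 (s1 g) (t1 g) (im12 g))
    (typed21 : forall g, @typed k S1 (s2 g) (t2 g) (im21 g))
    (rel12 : forall f g, R1 f g -> @ev k P2 (tmap im12 f) = @ev k P2 (tmap im12 g))
    (rel21 : forall f g, R2 f g -> @ev k P1 (tmap im21 f) = @ev k P1 (tmap im21 g)) :
  (forall g, @ev k P1 (tmap im21 (im12 g)) = @ev k P1 (@Gen k S1 g)) ->
  (forall g, @ev k P2 (tmap im12 (im21 g)) = @ev k P2 (@Gen k S2 g)) ->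
  slm_isomorphism (tmap_functor typed12 H1 rel12).
Proof.
move=> imK12 imK21; exists (tmap_functor typed21 H2 rel21).
by split=> // u v f; congr (pack _); apply: tmap_functorK.
Qed.

(** * The isomorphism *)

Section WebTermMap.
Variables (k : fieldType) (D1 D2 : Type) (th1 : D1 -> posnat) (th2 : D2 -> posnat).
Variables (im im_inv : D1 -> term k (web_sig th2)).

Definition web_im (g : web_gen D1) : term k (web_sig th2) :=
  match g with
  | WMerge a b => @Gen k (web_sig th2) (WMerge a b)
  | WSplit a b => @Gen k (web_sig th2) (WSplit a b)
  | WCross a b => @Gen k (web_sig th2) (WCross a b)
  | WCrossInv a b => @Gen k (web_sig th2) (WCrossInv a b)
  | WDot i => im i
  | WDotInv i => im_inv i
  end.

Definition wmap : term k (web_sig th1) -> term k (web_sig th2) :=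
  @tmap k posnat (web_gen D1) (web_gen D2) (web_src th1) (web_tgt th1)
    (web_src th2) (web_tgt th2) web_im.

Lemma wmap_merge a b : wmap (wmerge k th1 a b) = wmerge k th2 a b.
Proof. by rewrite /wmerge; case: insub => // a'; case: insub. Qed.

Lemma wmap_split a b : wmap (wsplit k th1 a b) = wsplit k th2 a b.
Proof. by rewrite /wsplit; case: insub => // a'; case: insub. Qed.

Lemma wmap_cross a b : wmap (wcross k th1 a b) = wcross k th2 a b.
Proof. by rewrite /wcross; case: insub => // a'; case: insub. Qed.

Lemma wmap_cross_inv a b : wmap (wcross_inv k th1 a b) = wcross_inv k th2 a b.
Proof. by rewrite /wcross_inv; case: insub => // a'; case: insub. Qed.

Lemma wmap_thicken f a : wmap (thicken f a) = thicken (wmap f) a.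
Proof.
rewrite /thicken /=; congr (_ \o (_ \o _))%T.
- by elim: (nseq a 1%N) => //= x s ->; rewrite -/wmap wmap_merge.
- by elim: a => //= a ->.
- by elim: (nseq a 1%N) => //= x s ->; rewrite -/wmap wmap_split.
Qed.

Lemma wmap_square_sum q a b c d :
  wmap (square_sum th1 q a b c d) = square_sum th2 q a b c d.
Proof.
have wmap_big (I : Type) (r : seq I) (Q : pred I) F u v :
    wmap (\big[@Add k (web_sig th1)/@Zero k (web_sig th1) u v]_(i <- r | Q i) F i) =
    \big[@Add k (web_sig th2)/@Zero k (web_sig th2) u v]_(i <- r | Q i) wmap (F i).
  exact: (big_morph wmap).
rewrite /square_sum wmap_big; apply: eq_bigr => s _; rewrite wmap_big.
apply: eq_bigr => t _; rewrite /square_summand.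
by rewrite -!wmap_merge -wmap_cross -!wmap_split.
Qed.

Lemma wmap_cmp f g : wmap (f \o g)%T = (wmap f \o wmap g)%T. Proof. by []. Qed.
Lemma wmap_tns f g : wmap (f \ox g)%T = (wmap f \ox wmap g)%T. Proof. by []. Qed.
Lemma wmap_scl c f : wmap (Scale c f) = Scale c (wmap f). Proof. by []. Qed.
Lemma wmap_idt a : wmap (idt k th1 a) = idt k th2 a. Proof. by []. Qed.
Definition wmapE := (wmap_cmp, wmap_tns, wmap_scl, wmap_idt, wmap_merge,
  wmap_split, wmap_cross, wmap_cross_inv, wmap_square_sum, wmap_thicken).

Variable q : k.
Variable R2 : term k (web_sig th2) -> term k (web_sig th2) -> Prop.
Hypothesis H2 : forall f g, R2 f g -> exists u v, typed u v f /\ typed u v g.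
Let P2 := Presentation H2.
Hypothesis common2 : forall f g, common_rel q f g -> R2 f g.
Hypothesis im_invl : forall i,
  @ev k P2 (im_inv i \o im i)%T = @ev k P2 (idt k th2 (th1 i)).
Hypothesis im_invr : forall i,
  @ev k P2 (im i \o im_inv i)%T = @ev k P2 (idt k th2 (th1 i)).

(** A substitution that fixes merges, splits and crossings carries the relations
without dots to themselves. *)
Lemma wmap_common f g : common_rel q f g -> @ev k P2 (wmap f) = @ev k P2 (wmap g).
Proof.
have common_ev f' g' : common_rel q f' g' -> @ev k P2 f' = @ev k P2 g'.
  by move=> h; apply: rel_ev; apply: common2.
case=> [a b c|a b c|a b c d e|a b|a b|a b|i|i]; rewrite !wmapE.
- exact/common_ev/merge_assoc.
- exact/common_ev/split_assoc.
- exact/common_ev/square.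
- exact/common_ev/digon.
- exact/common_ev/cross_invl.
- exact/common_ev/cross_invr.
- exact: im_invl.
- exact: im_invr.
Qed.
End WebTermMap.

Section Isomorphism.
Variables (k : fieldType) (q : k).
Hypothesis qint_neq0 : forall n, (0 < n)%N -> qint q n != 0.
Let P' := web'_pres q.
Let P := webdot_pres q.
Local Notation C' := (pres_diag P').
Local Notation W' := (web'_webs q).
Local Notation th := (@id posnat).

Let x := @ev k P' (dot1 k).
Let y := @ev k P' (dot1_inv k).

Definition web'_dot (a : nat) : term k web'_sig :=
  Scale (qfact q a)^-1 (thicken (dot1 k) a).

Definition web'_dot_inv (a : nat) : term k web'_sig :=
  Scale (qfact q a)^-1 (thicken (dot1_inv k) a).

Lemma ev_thicken (f : term k web'_sig) a : @ev k P' (thicken f a) =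
  cmp (merge_all W' a) (cmp (tensor_pow W' (@ev k P' f) a) (split_all W' a)).
Proof.
rewrite /thicken !evE; congr (cmp _ (cmp _ _)).
- by elim: a => //= a <-; rewrite !evE sumn_nseq mul1n.
- by elim: a => //= a <-; rewrite !evE.
- by elim: a => //= a <-; rewrite !evE sumn_nseq mul1n.
Qed.

Lemma merge_split1 n :
  cmp (mg W' 1 n) (sp W' 1 n) = scl (qint q n.+1) (idn (st W' n.+1)).
Proof. exact: web'_digon1. Qed.

Lemma merge_split_r n : exists2 c, c != 0 &
  cmp (mg W' n 1) (sp W' n 1) = scl c (idn (st W' n.+1)).
Proof. exact: web'_digonr. Qed.

Lemma ty_dot1 : @ty k C' (st W' 1) (st W' 1) x.
Proof. exact: (@dty_ev k P' _ _ _ (typed_dot1 k)). Qed.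

Lemma ty_dot1_inv : @ty k C' (st W' 1) (st W' 1) y.
Proof. exact: (@dty_ev k P' _ _ _ (typed_dot1_inv k)). Qed.

Lemma dot1_mul_inv : cmp x y = idn (st W' 1).
Proof.
by rewrite -ev_cmp; apply: (@common_ev k q); apply: (@dot_invr k unit thick1 q tt).
Qed.

Lemma dot1_inv_mul : cmp y x = idn (st W' 1).
Proof.
by rewrite -ev_cmp; apply: (@common_ev k q); apply: (@dot_invl k unit thick1 q tt).
Qed.

Lemma cross_invlE (a b : posnat) :
  cmp (@ev k P' (wcross_inv k thick1 a b)) (cr W' a b) = idn (mulw (st W' a) (st W' b)).
Proof. by rewrite -ev_cmp (common_ev (@cross_invl k unit thick1 q a b))
  ev_tns idnM. Qed.

Lemma cross_invrE (a b : posnat) :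
  cmp (cr W' a b) (@ev k P' (wcross_inv k thick1 a b)) = idn (mulw (st W' b) (st W' a)).
Proof. by rewrite -ev_cmp (common_ev (@cross_invr k unit thick1 q a b))
  ev_tns idnM. Qed.

Lemma cross_dot_cross : cmp (cr W' 1 1) (cmp (tns x (idn (st W' 1))) (cr W' 1 1)) =
  tns (idn (st W' 1)) x.
Proof.
have tix := ty_tns (ty_idn (st W' 1)) ty_dot1.
have := @rel_ev k P' _ _ (web'_dot_slide1 q); rewrite !evE => e.
rewrite cmpA e -cmpA.
by rewrite (cross_invlE pone pone) (cmp_idn tix).
Qed.

Lemma cross_dots : cmp (cr W' 1 1) (tns x x) = cmp (tns x x) (cr W' 1 1).
Proof. exact: cr_dots ty_dot1 cross_dot_cross. Qed.

(** [tns y y] is inverse to [tns x x]. *)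
Lemma cross_dots_inv : cmp (cr W' 1 1) (tns y y) = cmp (tns y y) (cr W' 1 1).
Proof.
have tyy := ty_tns ty_dot1_inv ty_dot1_inv; have txx := ty_tns ty_dot1 ty_dot1;
  have tc := ty_cr W' 1 1.
have yyxx : cmp (tns y y) (tns x x) = idn (mulw (st W' 1) (st W' 1)).
  by rewrite -(interchange ty_dot1_inv ty_dot1 ty_dot1_inv ty_dot1) dot1_inv_mul idnM.
have xxyy : cmp (tns x x) (tns y y) = idn (mulw (st W' 1) (st W' 1)).
  by rewrite -(interchange ty_dot1 ty_dot1_inv ty_dot1 ty_dot1_inv) dot1_mul_inv idnM.
rewrite -[LHS](idn_cmp (ty_cmp tc tyy)) -yyxx -cmpA (cmpA (tns x x))
  -cross_dots -cmpA xxyy.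
by rewrite (cmp_idn tc).
Qed.

Lemma ev_web'_dot a : @ev k P' (web'_dot a) = thick W' x a.
Proof.
rewrite /web'_dot evE ev_thicken
  (merge_pow_split qint_neq0 merge_split1 ty_dot1 cross_dots) sclA.
by rewrite mulVf ?scl1 // qfact_neq0.
Qed.

Lemma ev_web'_dot_inv a : @ev k P' (web'_dot_inv a) = thick W' y a.
Proof.
rewrite /web'_dot_inv evE ev_thicken
  (merge_pow_split qint_neq0 merge_split1 ty_dot1_inv cross_dots_inv) sclA.
by rewrite mulVf ?scl1 // qfact_neq0.
Qed.

Lemma web'_dot_invl a : cmp (thick W' y a) (thick W' x a) = idn (st W' a).
Proof.
rewrite (thick_cmp qint_neq0 merge_split1 a ty_dot1_inv ty_dot1 cross_dots_inv cross_dots).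
by rewrite dot1_inv_mul (thick_idn qint_neq0 merge_split1).
Qed.

Lemma web'_dot_invr a : cmp (thick W' x a) (thick W' y a) = idn (st W' a).
Proof.
rewrite (thick_cmp qint_neq0 merge_split1 a ty_dot1 ty_dot1_inv cross_dots cross_dots_inv).
by rewrite dot1_mul_inv (thick_idn qint_neq0 merge_split1).
Qed.

Lemma cross_slide1 (a b : posnat) :
  cmp (cr W' a b) (tns (thick W' x a) (idn (st W' b))) =
  cmp (tns (idn (st W' b)) (thick W' x a)) (@ev k P' (wcross_inv k thick1 b a)).
Proof.
have tx := ty_tns (ty_thick ty_dot1 a) (ty_idn (st W' b)).
rewrite -(dot_slide qint_neq0 merge_split1 merge_split_r ty_dot1 cross_dot_cross)
  -!cmpA cross_invrE.
by rewrite (cmp_idn tx).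
Qed.

Lemma cross_slide2 (a b : posnat) :
  cmp (tns (thick W' x b) (idn (st W' a))) (cr W' a b) =
  cmp (@ev k P' (wcross_inv k thick1 b a)) (tns (idn (st W' a)) (thick W' x b)).
Proof.
have tx := ty_tns (ty_thick ty_dot1 b) (ty_idn (st W' a)).
rewrite -(dot_slide qint_neq0 merge_split1 merge_split_r ty_dot1 cross_dot_cross)
  !cmpA cross_invlE -cmpA.
by rewrite (idn_cmp (ty_cmp tx (ty_cr W' a b))).
Qed.

Definition to_web : term k web'_sig -> term k webdot_sig :=
  @wmap k unit posnat thick1 th (fun _ => dot k 1) (fun _ => dot_inv k 1).

Definition of_web : term k webdot_sig -> term k web'_sig :=
  @wmap k posnat unit th thick1 (fun a => web'_dot a) (fun a => web'_dot_inv a).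

Lemma dot_posnat (a : posnat) : dot k a = @Gen k webdot_sig (WDot a).
Proof. by rewrite /dot valK. Qed.

Lemma dot_inv_posnat (a : posnat) : dot_inv k a = @Gen k webdot_sig (WDotInv a).
Proof. by rewrite /dot_inv valK. Qed.

Lemma to_web_rel f g : web'_rel q f g -> @ev k P (to_web f) = @ev k P (to_web g).
Proof.
case=> [{}f {}g fg||].
- apply: (wmap_common (q := q) (H2 := @webdot_rel_typed k q)) fg.
  + exact: webdot_common.
  + case; apply: (@rel_ev k P); apply: webdot_common.
    rewrite (dot_posnat pone) (dot_inv_posnat pone).
    exact: (@dot_invl k posnat th q pone).
  + case; apply: (@rel_ev k P); apply: webdot_common.
    rewrite (dot_posnat pone) (dot_inv_posnat pone).
    exact: (@dot_invr k posnat th q pone).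
- rewrite /to_web !wmapE; apply: (@rel_ev k P); exact: (@dot_slide1 k q pone pone).
- rewrite /to_web !wmapE; apply: (@rel_ev k P); exact: (@dot_slide2 k q pone pone).
Qed.

Lemma of_web_dot (a : nat) : @ev k P' (of_web (dot k a)) = thick W' x a.
Proof.
have [-> | [a' ->]] := posnat_cases a; last by rewrite dot_posnat -ev_web'_dot.
by rewrite /dot insub0.
Qed.

Lemma of_web_dot_inv (a : nat) : @ev k P' (of_web (dot_inv k a)) = thick W' y a.
Proof.
have [-> | [a' ->]] := posnat_cases a; last by rewrite dot_inv_posnat -ev_web'_dot_inv.
by rewrite /dot_inv insub0.
Qed.

Lemma of_web_rel f g : webdot_rel q f g -> @ev k P' (of_web f) = @ev k P' (of_web g).
Proof.
case=> [{}f {}g fg|a b|a b|a b|a b|a|a].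
- apply: (wmap_common (q := q) (H2 := @web'_rel_typed k q)) fg.
  + exact: web'_common.
  + by move=> a; rewrite ev_cmp ev_web'_dot ev_web'_dot_inv web'_dot_invl.
  + by move=> a; rewrite ev_cmp ev_web'_dot ev_web'_dot_inv web'_dot_invr.
- by rewrite /of_web !wmapE !evE !of_web_dot cross_slide1.
- by rewrite /of_web !wmapE !evE !of_web_dot cross_slide2.
- rewrite /of_web !wmapE !evE !of_web_dot.
  exact: (split_thick qint_neq0 merge_split1 ty_dot1 cross_dots).
- rewrite /of_web !wmapE !evE !of_web_dot.
  exact: (thick_merge qint_neq0 merge_split1 ty_dot1 cross_dots).
- rewrite /of_web wmap_thicken wmap_scl ev_thicken ev_scl !of_web_dot
  (thick_one qint_neq0 merge_split1 ty_dot1).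
  exact: (merge_pow_split qint_neq0 merge_split1 ty_dot1 cross_dots).
- rewrite /of_web wmap_thicken wmap_scl ev_thicken ev_scl !of_web_dot_inv
  (thick_one qint_neq0 merge_split1 ty_dot1_inv).
  exact: (merge_pow_split qint_neq0 merge_split1 ty_dot1_inv cross_dots_inv).
Qed.

Lemma to_web_dot (a : posnat) : @ev k P (to_web (web'_dot a)) = @ev k P (dot k a).
Proof.
rewrite /to_web wmap_scl wmap_thicken ev_scl (@rel_ev k P _ _ (dot_thicken q a)).
by rewrite ev_scl sclA mulVf ?scl1 // qfact_neq0.
Qed.

Lemma to_web_dot_inv (a : posnat) :
  @ev k P (to_web (web'_dot_inv a)) = @ev k P (dot_inv k a).
Proof.
rewrite /to_web wmap_scl wmap_thicken ev_scl (@rel_ev k P _ _ (dot_inv_thicken q a)).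
by rewrite ev_scl sclA mulVf ?scl1 // qfact_neq0.
Qed.

Lemma typed_to_web g : @typed k webdot_sig (web_src thick1 g) (web_tgt thick1 g)
  (@web_im k unit posnat th (fun _ => dot k 1) (fun _ => dot_inv k 1) g).
Proof.
case: g => [a b|a b|a b|a b|i|i] /=; try exact: (@typed_Gen k webdot_sig _).
- by rewrite -(strand_posnat pone); apply: typed_webdot.
- by rewrite -(strand_posnat pone); apply: typed_webdot_inv.
Qed.

Lemma typed_of_web g : @typed k web'_sig (web_src th g) (web_tgt th g)
  (@web_im k posnat unit thick1 (fun a => web'_dot a) (fun a => web'_dot_inv a) g).
Proof.
case: g => [a b|a b|a b|a b|a|a] /=; try exact: (@typed_Gen k web'_sig _).
- by rewrite -(strand_posnat a); apply: typed_thicken; apply: typed_dot1.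
- by rewrite -(strand_posnat a); apply: typed_thicken; apply: typed_dot1_inv.
Qed.

Definition web_functor : slmfunctor (Web' q) (Web q) :=
  tmap_functor typed_to_web (@web'_rel_typed k q) to_web_rel.

Lemma web_functor_iso : slm_isomorphism web_functor.
Proof.
refine (@tmap_isomorphism k posnat _ _ _ _ _ _ _ _ (@web'_rel_typed k q)
  (@webdot_rel_typed k q) _ _
  typed_to_web typed_of_web to_web_rel of_web_rel _ _).
- case=> [a b|a b|a b|a b|[]|[]] //=.
    by rewrite -[LHS]/(@ev k P' (of_web (dot k 1))) of_web_dot
      (thick_one qint_neq0 merge_split1 ty_dot1).
  by rewrite -[LHS]/(@ev k P' (of_web (dot_inv k 1))) of_web_dot_inv
    (thick_one qint_neq0 merge_split1 ty_dot1_inv).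
- case=> [a b|a b|a b|a b|a|a] //=.
    by rewrite -[LHS]/(@ev k P (to_web (web'_dot a))) to_web_dot dot_posnat.
  by rewrite -[LHS]/(@ev k P (to_web (web'_dot_inv a))) to_web_dot_inv dot_inv_posnat.
Qed.

Lemma web_functor_pack u v f g 
    (tf : @typed k web'_sig u v f) (tg : @typed k webdot_sig u v g) :
  @ev k P (to_web f) = @ev k P g ->
  pack (fun_hom web_functor (mor (P := P') tf)) = pack (mor (P := P) tg).
Proof.
move=> e; congr (pack _); rewrite [LHS]tmap_functor_mor; apply: eq_cls.
by apply: (@ev_eqvP k P u v) e; apply: typed_tmap tf; apply: typed_to_web.
Qed.
End Isomorphism.

Lemma qvar_neq0 (R : realType) : qvar R != 0.
Proof. by rewrite /qvar tofrac_eq0 polyX_eq0. Qed.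

(** The variable is not a root of unity, which makes quantum factorials
invertible. *)
Lemma qvar_expn_neq1 (R : realType) n : (0 < n)%N -> qvar R ^+ n != 1.
Proof.
move=> n0; rewrite /qvar -tofracXn -tofrac1 tofrac_eq; apply/eqP.
move=> /(congr1 (fun p : {poly R[i]} => size p)).
by rewrite size_polyXn size_poly1 => -[] e; rewrite e in n0.
Qed.

Lemma qint_qvar_neq0 (R : realType) n : (0 < n)%N -> qint (qvar R) n != 0.
Proof.
move=> n0; have q0 := qvar_neq0 R.
have sub m : (0 < m)%N -> qvar R ^+ m - qvar R ^- m != 0.
  move=> m0; have qm0 : qvar R ^+ m != 0 by rewrite expf_neq0.
  rewrite subr_eq0; apply/eqP => /(congr1 (fun z => qvar R ^+ m * z)).
  rewrite divff // -exprD => /eqP; apply/negP; apply: qvar_expn_neq1; lia.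
rewrite /qint mulf_neq0 ?invr_neq0 ?sub //.
exact: (sub 1%N).
Qed.

Local Close Scope ring_scope.

Theorem theorem2p13 (R : realType) :
  exists F : slmfunctor (WebC' R) (WebC R),
    slm_isomorphism F /\
    [/\ forall a : posnat, F [:: a] = [:: a],
        forall a b : posnat, pack (fun_hom F (web'_m R a b)) = pack (web_m R a b),
        forall a b : posnat, pack (fun_hom F (web'_s R a b)) = pack (web_s R a b)
      & forall a b : posnat, pack (fun_hom F (web'_c R a b)) = pack (web_c R a b)] /\
    [/\ pack (fun_hom F (web'_x1 R)) = pack (web_x R 1),
        forall a : posnat, 2 <= a -> pack (fun_hom F (web'_x R a)) = pack (web_x R a)
      & forall a : posnat, pack (fun_hom F (web'_xinv R a)) = pack (web_xinv R a)].
Proof.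
pose q0 := @qint_qvar_neq0 R.
exists (web_functor (qvar R)); split; first exact: web_functor_iso q0.
split; split=> //.
- by move=> a b; apply: web_functor_pack; rewrite /to_web wmap_merge.
- by move=> a b; apply: web_functor_pack; rewrite /to_web wmap_split.
- by move=> a b; apply: web_functor_pack; rewrite /to_web wmap_cross.
- exact: web_functor_pack.
- by move=> a _; apply: web_functor_pack; apply: to_web_dot q0 a.
- by move=> a; apply: web_functor_pack; apply: to_web_dot_inv q0 a.
Qed.
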